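(* Let $\rho\in\mathcal{P}_{a.c.}(\Omega)$ be such that there exist $m_\rho,M_\rho\in(0,+\infty)$ with $m_\rho\le\rho\le M_\rho$ on $\mathrm{spt}(\rho)$. Assume that $\mathrm{spt}(\rho)$ is connected and that there exist $N\ge1$ convex sets $(C_i)_{1\le i\le N}$ in $\Omega$ such that $\mathrm{spt}(\rho)=\bigcup_{i=1}^N C_i$. Also assume that for any $i\ne j$ such that $C_i\cap C_j\ne\emptyset$, one has $\rho(C_i\cap C_j)>0$. Then there exists a constant $c_\rho>0$ depending on $\rho$ such that for any $\psi,\tilde\psi\in\mathcal{C}(\Omega)$, $$\langle\psi-\tilde\psi\,|\,(\nabla\psi^* )_\#\rho\rangle+c_\rho\,\mathrm{Var}_\rho(\tilde\psi^*-\psi^* )\le\mathcal{K}_\rho(\tilde\psi)-\mathcal{K}_\rho(\psi).$$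
   Context: $\Omega=B(0,R)\subset\mathbb{R}^d$ is the compact (closed) Euclidean ball of radius $R>0$ centered at $0$. $\mathcal{P}_{a.c.}(\Omega)$ is the set of Borel probability measures on $\Omega$ that are absolutely continuous with respect to Lebesgue measure, identified with their densities; $\mathrm{spt}(\rho)$ is the support of $\rho$. $\mathcal{C}(\Omega)$ is the set of continuous real functions on $\Omega$, and for $\psi\in\mathcal{C}(\Omega)$, $\psi^*(x)=\sup_{y\in\Omega}\{\langle x|y\rangle-\psi(y)\}$. $\mathcal{K}_\rho(\psi)=\int_\Omega\psi^*\,d\rho$ is the Kantorovich functional. $\langle f|\sigma\rangle=\int f\,d\sigma$, and $\mathrm{Var}_\rho(f)$ is the variance of $f$ under $\rho$.
   Formalization: The convex sets C_i are additionally assumed closed; without this the claim fails for d ≥ 2, e.g. for two triangles meeting at one vertex, with that vertex removed from one of them. *)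

(* Defs.v *)
From HB Require Import structures.
From mathcomp Require Import all_boot all_order all_algebra.
From mathcomp Require Import all_classical all_reals all_analysis.
From mathcomp Require Import measurable_realfun.

Set Implicit Arguments.
Unset Strict Implicit.
Unset Printing Implicit Defensive.

Import Order.TTheory GRing.Theory Num.Theory.
Import numFieldNormedType.Exports.

Local Open Scope classical_set_scope.
Local Open Scope ring_scope.

(* Matrices, hence row vectors, carry the Borel sigma-algebra of their
   topology (the entrywise one, which is the Euclidean topology). *)
Section borel_matrix.
Context (R : realType) (m n : nat).

HB.instance Definition _ := @isMeasurable.Build
  (sigma_display (@open 'M[R]_(m, n))) 'M[R]_(m, n)
  <<s (@open 'M[R]_(m, n)) >>
  (@sigma_algebra0 _ setT (@open 'M[R]_(m, n)))
  (@sigma_algebraC _ (@open 'M[R]_(m, n)))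
  (@sigma_algebra_bigcup _ setT (@open 'M[R]_(m, n))).

Lemma open_measurable_mx (U : set 'M[R]_(m, n)) : open U -> measurable U.
Proof. exact: sub_sigma_algebra. Qed.

Lemma measurable_coord (i : 'I_m) (j : 'I_n) :
  measurable_fun [set: 'M[R]_(m, n)] (fun M : 'M[R]_(m, n) => M i j).
Proof.
apply: (measurability _ (RGenOpens.measurableE R)).
move=> _ [_ [a [b ->]] <-]; rewrite setTI; apply: open_measurable_mx.
move/continuousP: (@coord_continuous R m n i j); apply.
exact: interval_open.
Qed.

Lemma measurable_fun_mx d (T : measurableType d) (f : T -> 'M[R]_(m, n)) :
  (forall i j, measurable_fun [set: T] (fun t => f t i j)) ->
  measurable_fun [set: T] f.
Proof.
move=> mf; apply: (measurability (@open 'M[R]_(m, n))) => // _ [U oU <-].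
pose c (p : 'M[rat]_(m, n) * nat) : 'M[R]_(m, n) := map_mx ratr p.1.
pose P := [set p : 'M[rat]_(m, n) * nat | ball (c p) p.2.+1%:R^-1 `<=` U].
have -> : U = \bigcup_(p in P) ball (c p) p.2.+1%:R^-1.
  apply/seteqP; split => [x Ux|x [p Pp /Pp//]].
  have /nbhs_ballP[e /= e0 xeU] : nbhs x U by exact: open_nbhs_nbhs.
  have e20 : 0 < e / 2 by rewrite divr_gt0.
  have [k _ /(_ k (leqnn k))/= kE] := near_infty_natSinv_lt (PosNum e20).
  have k0 : 0 < k.+1%:R^-1 :> R by rewrite invr_gt0.
  have q_ (i : 'I_m) (j : 'I_n) : {q : rat | ball (ratr q : R) k.+1%:R^-1 (x i j)}.
    apply: cid; have : x i j - k.+1%:R^-1 < x i j + k.+1%:R^-1.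
      by rewrite ltrBlDr -addrA ltrDl addr_gt0.
    move=> /rat_in_itvoo[q]; rewrite in_itv/= => qx; exists q.
    by rewrite -ball_normE /= ltr_distl.
  pose q : 'M[rat]_(m, n) := \matrix_(i, j) sval (q_ i j).
  have qx : ball (c (q, k)) k.+1%:R^-1 x.
    by split => // i j; rewrite !mxE; exact: (proj2_sig (q_ i j)).
  exists (q, k) => //= y qy; apply: xeU.
  rewrite (splitr e); apply: (@ball_triangle _ _ (c (q, k))).
    exact: le_ball (ltW kE) _ (ball_sym qx).
  exact: le_ball (ltW kE) _ qy.
rewrite setTI preimage_bigcup bigcup_mkcond.
apply: countable_bigcupT_measurable => [|p]; first exact: countableP.
case: ifPn => // _.
rewrite (_ : _ @^-1` _ = \bigcap_(ij in [set: 'I_m * 'I_n])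
    ((fun t => f t ij.1 ij.2) @^-1` ball (c p ij.1 ij.2) p.2.+1%:R^-1)); last first.
  apply/seteqP; split=> [t [_ +] [i j] _|t h]; first exact.
  by split => [|i j]; [rewrite invr_gt0|exact: (h (i, j))].
apply: fin_bigcap_measurable => // -[i j] _ /=.
rewrite -[X in measurable X]setTI; apply: mf => //.
exact: measurable_ball.
Qed.

End borel_matrix.

(* The library's sigma-finiteness instance for product measures is not found
   by inference, so the fact is restated as a lemma. *)
Lemma product_sigma_finite d1 d2 (T1 : measurableType d1)
    (T2 : measurableType d2) (R : realType)
    (m1 : {sigma_finite_measure set T1 -> \bar R})
    (m2 : {sigma_finite_measure set T2 -> \bar R}) :
  sigma_finite setT (m1 \x m2)%E.
Proof.
have /sigma_finiteP[F [TF ndF Foo]] := sigma_finiteT m1.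
have /sigma_finiteP[G [TG ndG Goo]] := sigma_finiteT m2.
exists (fun n => F n `*` G n).
  rewrite -setXTT TF TG predeqE => -[x y]; split.
    move=> [/= [n _ Fnx] [k _ Gky]]; exists (maxn n k) => //; split.
    - by move: x Fnx; exact/subsetPset/ndF/leq_maxl.
    - by move: y Gky; exact/subsetPset/ndG/leq_maxr.
  by move=> [n _ []/= ? ?]; split; exists n.
move=> k; have [? ?] := Foo k; have [? ?] := Goo k.
split; first exact: measurableX.
by rewrite product_measure1E// lte_mul_pinfty// ge0_fin_numE.
Qed.

Section lebesgue_rV.
Context (R : realType).

Definition rV_cons d (p : measurableTypeR R * 'rV[R]_d) : 'rV[R]_(1 + d) :=
  row_mx (p.1%:M : 'rV[R]_1) p.2.

Lemma rV_cons0 d (p : measurableTypeR R * 'rV[R]_d) :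
  rV_cons p ord0 (ord0 : 'I_d.+1) = p.1.
Proof.
rewrite /rV_cons (_ : ord0 = @lshift 1 d ord0); last exact/val_inj.
by rewrite row_mxEl mxE eqxx.
Qed.

Lemma rV_consS d (p : measurableTypeR R * 'rV[R]_d) (i : 'I_d) :
  rV_cons p ord0 (lift ord0 i : 'I_d.+1) = p.2 ord0 i.
Proof.
rewrite /rV_cons (_ : lift ord0 i = @rshift 1 d i); last exact/val_inj.
by rewrite row_mxEr.
Qed.

Lemma measurable_rV_cons d :
  measurable_fun [set: measurableTypeR R * 'rV[R]_d] (@rV_cons d).
Proof.
apply: measurable_fun_mx => i j; rewrite -(splitK j).
case: (fintype.split j) => k /=.
  rewrite (_ : (fun _ => _) = fst); first exact: measurable_fst.
  by apply/funext => p; rewrite row_mxEl mxE !ord1 eqxx.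
rewrite (_ : (fun _ => _) = (fun v : 'rV[R]_d => v i k) \o snd).
  exact: measurableT_comp (measurable_coord _ _) measurable_snd.
by apply/funext => p /=; rewrite row_mxEr.
Qed.

Section lebesgue_rV_step.
Local Open Scope ereal_scope.
Variables (d : nat) (mu : {sigma_finite_measure set 'rV[R]_d -> \bar R}).

Definition lebesgue_rV_step : set 'rV[R]_(1 + d) -> \bar R :=
  pushforward (@lebesgue_measure R \x mu) (@rV_cons d).

Let step0 : lebesgue_rV_step set0 = 0.
Proof. by rewrite /lebesgue_rV_step /pushforward preimage_set0 measure0. Qed.

Let step_ge0 A : 0 <= lebesgue_rV_step A.
Proof. by rewrite /lebesgue_rV_step /pushforward; exact: measure_ge0. Qed.

Let step_measurable (A : set 'rV[R]_(1 + d)) :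
  measurable A -> measurable (@rV_cons d @^-1` A).
Proof.
by move=> mA; rewrite -[X in measurable X]setTI; exact: measurable_rV_cons.
Qed.

Let step_sigma_additive : semi_sigma_additive lebesgue_rV_step.
Proof.
move=> F mF tF mUF; rewrite /lebesgue_rV_step /pushforward preimage_bigcup.
apply: measure_semi_sigma_additive.
- by move=> n; exact: step_measurable.
- apply/trivIsetP => /= i j _ _ ij; rewrite -preimage_setI.
  by move/trivIsetP : tF => /(_ _ _ _ _ ij) ->//; rewrite preimage_set0.
- by rewrite -preimage_bigcup; exact: step_measurable.
Qed.

HB.instance Definition _ := isMeasure.Build _ _ _ lebesgue_rV_step
  step0 step_ge0 step_sigma_additive.

Let step_sigma_finite : sigma_finite setT lebesgue_rV_step.
Proof.
have [F TF mF] := product_sigma_finite (@lebesgue_measure R) mu.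
pose uncons (v : 'rV[R]_(1 + d)) : measurableTypeR R * 'rV[R]_d :=
  (v ord0 (lshift d ord0), rsubmx v).
have unconsK p : uncons (rV_cons p) = p.
  by case: p => a v; rewrite /uncons /rV_cons row_mxKr row_mxEl mxE eqxx.
have muncons : measurable_fun setT uncons.
  apply: measurable_fun_pair; first exact: measurable_coord.
  apply: measurable_fun_mx => i j.
  rewrite (_ : (fun _ => _) = (fun v : 'rV[R]_(1 + d) => v i (rshift 1 j))).
    exact: measurable_coord.
  by apply/funext => v; rewrite mxE.
exists (fun n => uncons @^-1` F n); first by rewrite -preimage_bigcup -TF.
move=> n; have [mFn Fnoo] := mF n; split.
  by rewrite -[X in measurable X]setTI; exact: muncons.
rewrite /lebesgue_rV_step /pushforward.
rewrite (_ : _ @^-1` _ = F n)//.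
by apply/seteqP; split => p /=; rewrite unconsK.
Qed.

HB.instance Definition _ :=
  Measure_isSigmaFinite.Build _ _ _ lebesgue_rV_step step_sigma_finite.

End lebesgue_rV_step.

(* Lebesgue measure on R^d: the d-fold product of the one on R. *)
Fixpoint lebesgue_rV d : {sigma_finite_measure set 'rV[R]_d -> \bar R} :=
  match d with
  | 0 => @dirac _ _ (0 : 'rV[R]_0) R
  | d'.+1 => lebesgue_rV_step (lebesgue_rV d')
  end.

End lebesgue_rV.

Lemma lebesgue_rV_box (R : realType) d (I : 'I_d -> set R) :
  (forall i, measurable (I i)) ->
  lebesgue_rV R d [set v | forall i, I i (v ord0 i)] =
  (\big[*%E/1]_(i < d) lebesgue_measure (I i))%E.
Proof.
elim: d I => [|d IH] I mI.
  by rewrite big_ord0 /= diracE mem_set//= => -[].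
pose B := [set v : 'rV[R]_d | forall i, I (lift ord0 i) (v ord0 i)].
have mB : measurable B.
  rewrite (_ : B = \bigcap_(i in [set: 'I_d])
      ((fun v : 'rV[R]_d => v ord0 i) @^-1` I (lift ord0 i))).
    apply: fin_bigcap_measurable => // i _; rewrite -[X in measurable X]setTI.
    exact: measurable_coord.
  by apply/seteqP; split => [v h i _|v h i]; [exact: h|exact: (h i)].
rewrite big_ord_recl -(IH (fun i => I (lift ord0 i)))// -/B.
rewrite -(product_measure1E (@lebesgue_measure R) (lebesgue_rV R d))//.
rewrite /= /lebesgue_rV_step /pushforward; congr product_measure1.
apply/seteqP; split => -[a v] /=.
  move=> h; split=> [|i]; first by have := h ord0; rewrite rV_cons0.
  by have := h (lift ord0 i); rewrite rV_consS.
move=> [Ia Iv] i; case: (unliftP ord0 i) => [j|] ->.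
  by rewrite rV_consS; exact: Iv.
by rewrite rV_cons0.
exact: mI.
Qed.

Section transport.
Context (R : realType) (d : nat).
Implicit Types (x y : 'rV[R]_d) (rho : set 'rV[R]_d -> \bar R).

Definition dotv x y : R := \sum_(i < d) x ord0 i * y ord0 i.

Definition enorm x : R := Num.sqrt (dotv x x).

(* The library's norm on 'rV[R]_d is the sup norm, so its balls are cubes. *)
Definition cball0 (r : R) : set 'rV[R]_d := [set x | enorm x <= r].

Definition spt rho : set 'rV[R]_d :=
  [set x | forall U, open U -> U x -> (0 < rho U)%E].

(* Taken in R, so meaningful when the set is nonempty and bounded above, which
   is the case for psi continuous on a nonempty compact set Om. *)
Definition conjugate (Om : set 'rV[R]_d) (psi : 'rV[R]_d -> R) x : R :=
  sup [set dotv x y - psi y | y in Om].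

(* Where a partial derivative does not exist, the corresponding entry is an
   unspecified constant; for f convex this is a Lebesgue-null set. *)
Definition gradient (f : 'rV[R]_d -> R) x : 'rV[R]_d :=
  \row_i 'D_(delta_mx ord0 i) f x.

Definition kantorovich (Om : set 'rV[R]_d) rho (psi : 'rV[R]_d -> R) : \bar R :=
  (\int[rho]_(x in Om) (conjugate Om psi x)%:E)%E.

End transport.
Arguments cball0 {R} d r.

Local Open Scope charge_scope.

(* Density of rho with respect to Lebesgue measure; it is only determined up to
   a null set, and meaningful when rho is absolutely continuous. *)
Definition density (R : realType) (d : nat) (rho : probability 'rV[R]_d R) :
    'rV[R]_d -> \bar R :=
  'd (charge_of_finite_measure rho) '/d (lebesgue_rV R d).

(* Main.v *)
From HB Require Import structures.
Require Import Defs.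
From mathcomp Require Import all_boot all_order all_algebra.
From mathcomp Require Import all_classical all_reals all_analysis.
From mathcomp Require Import measurable_realfun ring lra.

(** Let [phi] and [phit] be the conjugates of [psi] and [psit], and
    [u = phit - phi]. Both conjugates are [r]-Lipschitz, and for almost every [x]
    the gradient [y] of [phi] at [x] is the point where the supremum defining
    [phi x] is attained, so that [phi x = dotv x y - psi y]. The difference of
    the two sides of the inequality, without the variance, is therefore the
    integral of the Fenchel-Young gap [phit x + psit y - dotv x y]. Since
    [psit y] is at least [dotv (x + w) y - phit (x + w)] for every [w], and
    [dotv w y] is at least [phi x - phi (x - w)] by convexity of [phi], this gap
    is at least the gain
    [[
      G x = sup_w (phit x - phit (x + w) + phi x - phi (x - w))
    ]]
    ([kantorovich_gap]). It remains to bound the variance of [u] by a constant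
    times the integral of [G], which is a Poincare inequality with an unusual
    energy ([variance_le_gain]).

    The key is an estimate on segments ([sqr_variation_le]). On the segment
    [x + t *: e], take [w = h *: e] with one and the same [h] for all [t]. The
    integrals over [t] of [phit x - phit (x + w)] and of [phi x - phi (x - w)]
    reduce to boundary terms, and up to [4 * r ^+ 2 * h ^+ 2] they add up to
    [h * (u x - u (x + e))]. With the best [h], the square of [u x - u (x + e)]
    is at most [16 * r ^+ 2] times the integral of [G] along the segment.

    On a convex piece [C] of the support this is averaged over the pairs of end
    points ([poincare_convex]). For a fixed end point the points at a fixed
    proportion of the segments are the images of [C] under a homothety, which
    distorts Lebesgue measure, and hence [rho], by a bounded factor
    ([integral_homothety_le]). This yields a constant [a] such that the integral
    of the square of [u - a] over [C] is controlled. Pieces that meet overlap in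
    a set of positive measure, on which their constants can be compared; as the
    pieces are closed and the support is connected, one constant serves for all
    of them ([common_deviation_setT]).

    Almost everywhere differentiability of [phi] follows from the translation
    invariance of Lebesgue measure: along a line the jumps of the slope of a
    Lipschitz convex function have a bounded sum, so that the set where the jump
    exceeds a given threshold has many translates with bounded overlap
    ([lebesgue_not_derivable]). *)

Set Implicit Arguments.
Unset Strict Implicit.
Unset Printing Implicit Defensive.

Import Order.TTheory GRing.Theory Num.Theory.
Import numFieldNormedType.Exports.

Local Open Scope classical_set_scope.
Local Open Scope ring_scope.

(** * Euclidean norm and Lipschitz functions *)

Section euclidean.
Context (R : realType) (d : nat).
Implicit Types x y z : 'rV[R]_d.

Lemma dotvC x y : dotv x y = dotv y x.
Proof. by apply: eq_bigr => i _; rewrite mulrC. Qed.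

Lemma dotvDl x y z : dotv (x + y) z = dotv x z + dotv y z.
Proof. by rewrite -big_split; apply: eq_bigr => i _; rewrite mxE mulrDl. Qed.

Lemma dotvZl a x z : dotv (a *: x) z = a * dotv x z.
Proof. by rewrite mulr_sumr; apply: eq_bigr => i _; rewrite mxE mulrA. Qed.

Lemma dotvBl x y z : dotv (x - y) z = dotv x z - dotv y z.
Proof. by rewrite dotvDl -scaleN1r dotvZl mulN1r. Qed.

Lemma dotv_delta i z : dotv (delta_mx ord0 i) z = z ord0 i.
Proof.
rewrite /dotv (bigD1 i)//= mxE !eqxx mul1r big1 ?addr0// => j ji.
by rewrite mxE (negbTE ji) andbF mul0r.
Qed.

Lemma dotv_ge0 x : 0 <= dotv x x.
Proof. by apply: sumr_ge0 => i _; exact: sqr_ge0. Qed.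

Lemma enorm_ge0 x : 0 <= enorm x.
Proof. exact: sqrtr_ge0. Qed.

Lemma sqr_enorm x : enorm x ^+ 2 = dotv x x.
Proof. by rewrite sqr_sqrtr ?dotv_ge0. Qed.

Lemma enormZ a x : enorm (a *: x) = `|a| * enorm x.
Proof.
rewrite /enorm dotvZl dotvC dotvZl mulrA -expr2.
by rewrite sqrtrM ?sqr_ge0// sqrtr_sqr.
Qed.

Lemma enorm0 : enorm (0 : 'rV[R]_d) = 0.
Proof. by rewrite -(scale0r (0 : 'rV[R]_d)) enormZ normr0 mul0r. Qed.

Lemma enormN x : enorm (- x) = enorm x.
Proof. by rewrite -scaleN1r enormZ normrN1 mul1r. Qed.

(** Cauchy-Schwarz: [c *: x - b *: y] is, up to a factor, the component of [x]
    orthogonal to [y]. *)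
Lemma dotv_le x y : `|dotv x y| <= enorm x * enorm y.
Proof.
rewrite -(@ler_pXn2r _ 2)// ?nnegrE ?mulr_ge0 ?enorm_ge0//.
rewrite exprMn !sqr_enorm real_normK ?num_real//.
set a := dotv x x; set b := dotv x y; set c := dotv y y.
have [c0|] := eqVneq c 0.
  have : b = 0.
    rewrite /b /dotv big1// => i _; have /psumr_eq0P : c = 0 by [].
    move=> /(_ (fun i _ => sqr_ge0 (y ord0 i))) /(_ i isT) /eqP.
    by rewrite mulf_eq0 orbb => /eqP ->; rewrite mulr0.
  by move=> ->; rewrite c0 expr0n mulr0.
move=> c0; have {}c0 : 0 < c by rewrite lt_neqAle eq_sym c0 dotv_ge0.
have := dotv_ge0 (c *: x - b *: y).
rewrite dotvBl !(dotvC _ (_ - _)) !dotvBl !(dotvZl, dotvC _ (_ *: _)).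
rewrite -!/a -!/c -!/b (dotvC y x) -/b => h.
have : 0 <= c * (a * c - b ^+ 2) by nra.
by rewrite pmulr_rge0// subr_ge0.
Qed.

Lemma enormD x y : enorm (x + y) <= enorm x + enorm y.
Proof.
rewrite -(@ler_pXn2r _ 2)// ?nnegrE ?addr_ge0 ?enorm_ge0//.
rewrite sqr_enorm dotvDl !(dotvC _ (_ + _)) !dotvDl (dotvC y x).
rewrite sqrrD !sqr_enorm; have := le_trans (ler_norm _) (dotv_le x y); lra.
Qed.

Lemma coord_le_enorm x i : `|x ord0 i| <= enorm x.
Proof.
rewrite -(@ler_pXn2r _ 2)// ?nnegrE ?enorm_ge0//.
rewrite sqr_enorm real_normK ?num_real// /dotv (bigD1 i)//= -expr2 lerDl.
by apply: sumr_ge0 => j _; exact: sqr_ge0.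
Qed.

Lemma norm_le_enorm x : `|x| <= enorm x.
Proof.
rewrite [leLHS]/Num.norm/= mx_normrE; apply/bigmax_leP => /=; split.
  exact: enorm_ge0.
by move=> [i j] _; rewrite /= ord1 coord_le_enorm.
Qed.

Lemma coord_le_norm x i : `|x ord0 i| <= `|x|.
Proof.
rewrite [leRHS]/Num.norm/= mx_normrE.
by apply/bigmax_geP; right; exists (ord0, i).
Qed.

Lemma enorm_le_norm x : enorm x <= d%:R * `|x|.
Proof.
rewrite -(@ler_pXn2r _ 2)// ?nnegrE ?enorm_ge0 ?mulr_ge0//.
rewrite sqr_enorm exprMn; apply: (@le_trans _ _ (\sum_(i < d) `|x| ^+ 2)).
  apply: ler_sum => i _; rewrite -expr2 -real_normK ?num_real//.
  by rewrite ler_pXn2r ?nnegrE// coord_le_norm.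
rewrite sumr_const card_ord -[leLHS]mulr_natl ler_wpM2r ?sqr_ge0// expr2.
by rewrite -natrM ler_nat; case: (d) => // n; rewrite leq_pmulr.
Qed.

End euclidean.

(** The Euclidean norm is the one for which a conjugate over the ball of radius
    [r] has constant [r], in every dimension. *)
Definition elipschitz (R : realType) (d : nat) (k : R) (f : 'rV[R]_d -> R) :=
  forall x y, `|f x - f y| <= k * enorm (x - y).

Section elipschitz.
Context (R : realType) (d : nat).
Implicit Types (f : 'rV[R]_d -> R) (k : R).

Lemma elipschitz_continuous k f : 0 <= k -> elipschitz k f -> continuous f.
Proof.
move=> k0 fk x; apply: (@cvgrPdist_le _ _ _ (nbhs x) (nbhs_filter x) f (f x)).2 => e e0.
have kd : 0 < k * d%:R + 1 by rewrite ltr_wpDl ?mulr_ge0.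
have ekd : 0 < e / (k * d%:R + 1) by exact: divr_gt0.
apply: filterS (nbhsx_ballx x _ ekd) => y; rewrite -ball_normE/= => xy.
apply: (le_trans (fk x y)).
apply: (@le_trans _ _ ((k * d%:R + 1) * `|x - y|)).
  rewrite mulrDl -mulrA ler_wpDr ?mul1r// ler_wpM2l//.
  exact: enorm_le_norm.
by rewrite mulrC -ler_pdivlMr// ltW.
Qed.

Lemma enorm_lipschitz : elipschitz 1 (@enorm R d).
Proof.
move=> x y; rewrite mul1r ler_norml; apply/andP; split.
  by have := enormD (y - x) x; rewrite subrK -(opprB x y) enormN; lra.
by have := enormD (x - y) y; rewrite subrK; lra.
Qed.

Lemma closed_cball0 r : closed (@cball0 R d r).
Proof.
rewrite (_ : cball0 d r = @enorm R d @^-1` [set x | x <= r])//.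
apply: preimage_closed; last exact: closed_le.
by move=> x _; exact: (elipschitz_continuous ler01 enorm_lipschitz).
Qed.

Lemma compact_cball0 r : compact (@cball0 R d r).
Proof.
apply: bounded_closed_compact; last exact: closed_cball0.
exists r; split; first exact: num_real.
move=> M rM x xr; apply: ltW; apply: le_lt_trans rM.
exact: le_trans (norm_le_enorm x) xr.
Qed.

Lemma cball0_0 r : 0 <= r -> cball0 d r (0 : 'rV[R]_d).
Proof. by rewrite /cball0/= enorm0. Qed.

Lemma closed_measurable_mx (A : set 'rV[R]_d) : closed A -> measurable A.
Proof.
by move=> cA; rewrite -(setCK A); apply: measurableC; apply: open_measurable_mx; exact: closed_openC.
Qed.

Lemma measurable_cball0 r : measurable (@cball0 R d r).
Proof. by apply: closed_measurable_mx; exact: closed_cball0. Qed.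

Lemma continuous_measurable_mx f : continuous f -> measurable_fun setT f.
Proof.
move=> cf; apply: (measurability _ (RGenOpens.measurableE R)).
move=> _ [_ [a [b ->]] <-]; rewrite setTI; apply: open_measurable_mx.
by move/continuousP: cf; apply; exact: interval_open.
Qed.

Lemma affine_homothety_measurable (a : R) (b : 'rV[R]_d) :
  measurable_fun setT (fun x : 'rV[R]_d => a *: x + b).
Proof.
apply: measurable_fun_mx => i j.
rewrite (_ : (fun _ => _) = (fun x : 'rV[R]_d => a * x i j + b i j)).
  apply: measurable_funD => //; apply: measurable_funM => //.
  exact: measurable_coord.
by apply/funext => x; rewrite !mxE.
Qed.

End elipschitz.

(** * Lebesgue measure under homotheties *)

Section homothety.
Context (R : realType).

Section scaled_pushforward.
Context d1 d2 (T1 : measurableType d1) (T2 : measurableType d2).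
Variables (k : {nonneg R}) (f : T1 -> T2).
Variables (mf : measurable_fun setT f) (mu : {measure set T1 -> \bar R}).

Let preimage_measurable A : measurable A -> measurable (f @^-1` A).
Proof. by move=> mA; rewrite -[X in measurable X]setTI; exact: mf. Qed.

(** The proof [mf] is an argument so that the measure structure can be inferred
    from the term: the uniqueness theorems below take a bundled measure. *)
Definition scaled_pushforward of measurable_fun setT f :=
  fun A : set T2 => (k%:num%:E * mu (f @^-1` A))%E.

Local Notation m := (scaled_pushforward mf).

Let scaled_pushforward0 : m set0 = 0%E.
Proof. by rewrite /scaled_pushforward preimage_set0 measure0 mule0. Qed.

Let scaled_pushforward_ge0 A : (0 <= m A)%E.
Proof. by rewrite /scaled_pushforward mule_ge0. Qed.

Let scaled_pushforward_sigma_additive : semi_sigma_additive m.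
Proof.
move=> F mF tF mUF.
have := @measure_semi_sigma_additive _ _ _ (mscale k mu)
  (fun n => f @^-1` F n).
rewrite -preimage_bigcup; apply.
- by move=> n; exact: preimage_measurable.
- apply/trivIsetP => /= i j _ _ ij; rewrite -preimage_setI.
  by move/trivIsetP : tF => /(_ _ _ _ _ ij) ->//; rewrite preimage_set0.
- exact: preimage_measurable.
Qed.

HB.instance Definition _ := isMeasure.Build _ _ _ m
  scaled_pushforward0 scaled_pushforward_ge0 scaled_pushforward_sigma_additive.

End scaled_pushforward.

Lemma lebesgue_affine (a b : R) (A : set (measurableTypeR R)) :
  0 < a -> measurable A ->
  lebesgue_measure A =
    (a%:E * lebesgue_measure ((fun s => (a * s + b)%R) @^-1` A))%E.
Proof.
move=> a0 mA.
have mf : measurable_fun [set: measurableTypeR R]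
    ((fun s => a * s + b) : measurableTypeR R -> measurableTypeR R).
  by apply: measurable_funD => //; exact: measurable_funM.
have := @lebesgue_measure_unique R
  (scaled_pushforward (NngNum (ltW a0)) lebesgue_measure mf).
apply => // _ [[x y] _ <-] /=.
rewrite /scaled_pushforward/=.
rewrite (_ : _ @^-1` _ = `](x - b) / a, (y - b) / a]%classic); last first.
  apply/seteqP; split => s /=; rewrite !in_itv/= ltr_pdivrMr// ler_pdivlMr//.
    by rewrite mulrC ltrBlDr lerBrDr.
  by rewrite mulrC ltrBlDr lerBrDr.
rewrite !lebesgue_measure_itv/= !lte_fin ltr_pM2r ?invr_gt0// ltrD2r.
case: ifPn => _; last by rewrite mule0.
rewrite -!EFinB -EFinM; congr EFin; field.
by rewrite gt_eqF.
Qed.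

(** The product formula on boxes determines Lebesgue measure, so the scaling
    factor is the product of the factors along the coordinates. *)
Lemma lebesgue_homothety d (a : R) (b : 'rV[R]_d) (A : set 'rV[R]_d) :
  0 < a -> measurable A ->
  lebesgue_rV R d A =
    ((a ^+ d)%:E * lebesgue_rV R d ((fun x => a *: x + b)%R @^-1` A))%E.
Proof.
move=> a0; elim: d b A => [|d IH] b A mA.
  rewrite expr0 mul1e; congr (lebesgue_rV R 0 _).
  by apply/seteqP; split => x /=; rewrite (_ : a *: x + b = x)//;
    apply/matrixP => i [].
pose b1 : R := b ord0 ord0.
pose b2 : 'rV[R]_d := \row_i b ord0 (lift ord0 i).
pose f1 : measurableTypeR R -> measurableTypeR R := fun s => a * s + b1.
pose f2 (x : 'rV[R]_d) := a *: x + b2.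
pose f (p : measurableTypeR R * 'rV[R]_d) := (f1 p.1, f2 p.2).
have mf1 : measurable_fun setT f1.
  by apply: measurable_funD => //; exact: measurable_funM.
have mf2 : measurable_fun setT f2 by exact: affine_homothety_measurable.
have mf : measurable_fun setT f.
  apply: measurable_fun_pair.
    exact: measurableT_comp mf1 measurable_fst.
  exact: measurableT_comp mf2 measurable_snd.
have consf p : rV_cons (f p) = a *: rV_cons p + b.
  apply/rowP => i; rewrite [RHS]mxE [X in _ = X + _]mxE.
  case: (unliftP ord0 i) => [j|] ->; last by rewrite !rV_cons0.
  by rewrite !rV_consS /= !mxE.
have mA' : measurable (@rV_cons R d @^-1` A).
  by rewrite -[X in measurable X]setTI; exact: measurable_rV_cons.
have ad0 : 0 <= a ^+ d.+1 by rewrite exprn_ge0// ltW.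
have := @product_measure_unique _ _ _ _ R lebesgue_measure (lebesgue_rV R d)
  (scaled_pushforward (NngNum ad0) (lebesgue_measure \x lebesgue_rV R d)%E mf)
  _ _ mA'.
rewrite /= /lebesgue_rV_step /pushforward => ->.
- congr (_ * product_measure1 _ _ _)%E.
  by apply/seteqP; split => p /=; rewrite consf.
- move=> B1 B2 mB1 mB2; rewrite /scaled_pushforward/=.
  rewrite (_ : f @^-1` _ = (f1 @^-1` B1) `*` (f2 @^-1` B2))//.
  have mfB1 : measurable (f1 @^-1` B1).
    by rewrite -[X in measurable X]setTI; exact: mf1.
  have mfB2 : measurable (f2 @^-1` B2).
    by rewrite -[X in measurable X]setTI; exact: mf2.
  rewrite product_measure1E//.
  rewrite (lebesgue_affine b1 a0 mB1) (IH b2 _ mB2) exprS EFinM.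
  by rewrite muleACA.
Qed.

Lemma lebesgue_translation d (b : 'rV[R]_d) (A : set 'rV[R]_d) :
  measurable A ->
  lebesgue_rV R d A = lebesgue_rV R d ((fun x => x + b) @^-1` A).
Proof.
move=> mA; rewrite (lebesgue_homothety b ltr01 mA) expr1n mul1e.
by congr (lebesgue_rV R d _); apply/seteqP; split => x /=; rewrite scale1r.
Qed.

Lemma lebesgue_cball0_lty d (r : R) :
  (lebesgue_rV R d (cball0 d r) < +oo)%E.
Proof.
pose B := [set v : 'rV[R]_d | forall i, `[- r, r]%classic (v ord0 i)].
have mB : measurable B.
  rewrite (_ : B = \bigcap_(i in [set: 'I_d])
      ((fun v : 'rV[R]_d => v ord0 i) @^-1` `[- r, r]%classic)).
    apply: fin_bigcap_measurable => // i _; rewrite -[X in measurable X]setTI.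
    by apply: measurable_coord => //; exact: measurable_itv.
  by apply/seteqP; split => [v h i _|v h i]; [exact: h|exact: (h i)].
apply: (@le_lt_trans _ _ (lebesgue_rV R d B)).
  apply: le_measure; rewrite ?inE//; first exact: measurable_cball0.
  move=> x xr i /=; rewrite in_itv/= -ler_norml.
  exact: le_trans (coord_le_enorm x i) xr.
rewrite (@lebesgue_rV_box R d (fun=> `[- r, r]%classic))//.
suff : (\big[*%E/1]_(i < d) lebesgue_measure `[(- r)%R, r])%E \is a fin_num.
  by move=> /fin_numPlt/andP[].
apply: (big_ind (fun x : \bar R => x \is a fin_num)) => // [x y|i _]; first exact: fin_numM.
by rewrite lebesgue_measure_itv/=; case: ifPn.
Qed.

End homothety.

(** * Opposite shifts on a segment *)

Section segment.
Context (R : realType).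
Implicit Types (f g : R -> R) (L : R).

Definition lipschitz1 L f := forall s t, `|f s - f t| <= L * `|s - t|.

Lemma lipschitz1_continuous L f : 0 <= L -> lipschitz1 L f -> continuous f.
Proof.
move=> L0 fL x; apply/cvgrPdist_le => e e0.
have L1 : 0 < L + 1 by rewrite ltr_wpDl.
have eL : 0 < e / (L + 1) by exact: divr_gt0.
apply: filterS (nbhsx_ballx x _ eL) => y; rewrite -ball_normE/= => xy.
apply: (le_trans (fL x y)).
apply: (@le_trans _ _ ((L + 1) * `|x - y|)).
  by rewrite ler_wpM2r// lerDl.
by rewrite mulrC -ler_pdivlMr// ltW.
Qed.

(** The unit interval is enlarged on both sides because functions on a segment
    parametrized by it will be shifted by up to [1 / 2]. *)
Lemma ex_primitive f : continuous f ->
  exists P : R -> R, forall x : R, x \in `]-2, 2[ -> is_derive x 1 P (f x).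
Proof.
move=> cf; exists (fun x => \int[lebesgue_measure]_(t in `[-2, x]) f t)%R.
move=> x; rewrite in_itv/= => /andP[x2 x2'].
have intf : lebesgue_measure.-integrable `[-2, 2] (EFin \o f).
  apply: continuous_compact_integrable; first exact: segment_compact.
  exact: continuous_subspaceT.
have [dF F'] := continuous_FTC1_closed x2' intf x2 (cf x).
by rewrite -F' derive1E; exact: derivableP.
Qed.

Lemma primitive_lipschitz L f (P : R -> R) (a b : R) : 0 <= L -> lipschitz1 L f ->
  (forall x : R, x \in `]-2, 2[ -> is_derive x 1 P (f x)) ->
  a \in `]-2, 2[ -> b \in `]-2, 2[ ->
  `|P b - P a - (b - a) * f a| <= L * (b - a) ^+ 2.
Proof.
move=> L0 fL dP.
suff H (a' b' c : R) : c \in `[a', b'] -> a' \in `]-2, 2[ -> b' \in `]-2, 2[ ->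
    a' <= b' ->
    exists2 z, `|z - c| <= b' - a' & P b' - P a' = f z * (b' - a').
  move=> ia ib; have [ab|/ltW ba] := leP a b.
    have [|z zb ->] := H _ _ a _ ia ib ab; first by rewrite in_itv/= lexx.
    rewrite -mulrC -mulrBr normrM ger0_norm ?subr_ge0// expr2 mulrCA.
    rewrite ler_wpM2l ?subr_ge0//; apply: (le_trans (fL _ _)).
    by rewrite ler_wpM2l.
  have [|z zb Pab] := H _ _ a _ ib ia ba; first by rewrite in_itv/= lexx ba.
  rewrite (_ : _ - _ = (a - b) * (f a - f z)); last first.
    have -> : P b = P a - f z * (a - b) by rewrite -Pab; ring.
    ring.
  rewrite normrM ger0_norm ?subr_ge0// -sqrrN opprB expr2 mulrCA.
  rewrite ler_wpM2l ?subr_ge0//; apply: (le_trans (fL _ _)).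
  by rewrite ler_wpM2l// distrC.
rewrite !in_itv/= => /andP[ac cb] /andP[a1 a2] /andP[b1 b2] ab.
have dPab (x : R) : x \in `]a', b'[ -> is_derive x 1 P (f x).
  rewrite in_itv/= => /andP[ax xb]; apply: dP.
  by rewrite in_itv/= (lt_trans a1 ax) (lt_trans xb b2).
have cP : {within `[a', b'], continuous P}.
  apply: derivable_within_continuous => x; rewrite in_itv/= => /andP[ax xb].
  have : is_derive x 1 P (f x).
    by apply: dP; rewrite in_itv/= (lt_le_trans a1 ax) (le_lt_trans xb b2).
  by case.
have [z zab Pz] := MVT_segment ab dPab cP.
exists z => //; move: zab; rewrite in_itv/= => /andP[az zb].
rewrite ler_norml; apply/andP; split; lra.
Qed.

(** The integral of the left-hand side of the hypothesis on [G] consists of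
    boundary terms: it only sees [f] and [g] near the end points of the segment,
    where they vary by at most [L * `|h|]. Since [f] and [g] are shifted in
    opposite directions, the boundary terms combine into the variation of
    [g - f]. *)
Lemma integral_opposite_shifts L f g (G : R -> R) (h : R) : 0 <= L ->
  lipschitz1 L f -> lipschitz1 L g -> continuous G -> `|h| <= 1 / 2 ->
  (forall t, g t - g (t + h) + f t - f (t - h) <= G t) ->
  ((h * ((g 0 - f 0) - (g 1 - f 1)) - 4 * L * h ^+ 2)%:E <=
    \int[lebesgue_measure]_(t in `[0%R, 1%R]) (G t)%:E)%E.
Proof.
move=> L0 fL gL cG hh KG.
have cf := lipschitz1_continuous L0 fL.
have cg := lipschitz1_continuous L0 gL.
have [F dF] := ex_primitive cf; have [H dH] := ex_primitive cg.
pose k t := g t - g (t + h) + f t - f (t - h).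
pose K t := H t - H (t + h) + F t - F (t - h).
have ck : continuous k.
  move=> t; apply: cvgB; last first.
    by apply: continuous_comp; [apply: cvgB => //; exact: cvg_cst|exact: cf].
  apply: cvgD; last exact: cf.
  apply: cvgB; first exact: cg.
  by apply: continuous_comp; [apply: cvgD => //; exact: cvg_cst|exact: cg].
have h2 : - (1 / 2) <= h <= 1 / 2 by rewrite -ler_norml.
have dshift (a : R) (P p : R -> R) (t : R) : (forall x : R, x \in `]-2, 2[ -> is_derive x 1 P (p x)) ->
    t + a \in `]-2, 2[ -> is_derive t 1 (fun s => P (s + a)) (p (t + a)).
  move=> dP ta; have := dP _ ta => dPta.
  have dta : is_derive t 1 (fun s : R => s + a) 1.
    by have := is_deriveD (is_derive_id t 1) (is_derive_cst a t 1); rewrite addr0.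
  by have := @is_derive1_comp R P (fun s : R => s + a) t _ _ dPta dta; rewrite mulr1.
have dK (t : R) : t \in `[0, 1] -> is_derive t 1 K (k t).
  rewrite in_itv/= => /andP[t0 t1].
  have dH0 : is_derive t 1 H (g t) by apply: dH; rewrite in_itv/=; lra.
  have dF0 : is_derive t 1 F (f t) by apply: dF; rewrite in_itv/=; lra.
  have dHh : is_derive t 1 (fun s => H (s + h)) (g (t + h)).
    by apply: dshift => //; rewrite in_itv/=; lra.
  have dFh : is_derive t 1 (fun s => F (s - h)) (f (t - h)).
    by apply: dshift => //; rewrite in_itv/=; lra.
  exact: is_deriveB.
have wK : {within `[0, 1], continuous K}.
  by apply: derivable_within_continuous => x /dK[].
have K01 : (\int[lebesgue_measure]_(t in `[0%R, 1%R]) (k t)%:E =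
            (K 1)%:E - (K 0)%:E)%E.
  apply: continuous_FTC2 => //.
  - exact: continuous_subspaceT.
  - have [_ K0 K1] := (continuous_within_itvP K (@ltr01 R)).1 wK.
    split => // x /subset_itv_oo_cc/dK[]//.
  - by move=> x /subset_itv_oo_cc/dK[dKx <-]; rewrite derive1E.
have int (c : R -> R) : continuous c ->
    lebesgue_measure.-integrable `[0%R, 1%R] (EFin \o (c : R -> R)).
  move=> cc; apply: continuous_compact_integrable; first exact: segment_compact.
  exact: continuous_subspaceT.
apply: (@le_trans _ _ (\int[lebesgue_measure]_(t in `[0%R, 1%R]) (k t)%:E)%E);
  last first.
  by apply: le_integral => //; [exact: int|exact: int|move=> t _; rewrite lee_fin KG].
rewrite K01 -EFinB lee_fin.
have bound (P p : R -> R) (a c : R) : lipschitz1 L p ->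
    (forall x : R, x \in `]-2, 2[ -> is_derive x 1 P (p x)) ->
    0 <= a <= 1 -> `|c| <= 1 / 2 ->
    `|P (a + c) - P a - c * p a| <= L * c ^+ 2.
  move=> pL dP a01; rewrite ler_norml => c2.
  have := @primitive_lipschitz L p P a (a + c) L0 pL dP.
  rewrite (_ : a + c - a = c); last by ring.
  by apply; rewrite in_itv/=; lra.
have NH : `|- h| <= 1 / 2 by rewrite normrN.
have := bound H g 1 h gL dH ltac:(lra) hh.
have := bound H g 0 h gL dH ltac:(lra) hh.
have := bound F f 1 (- h) fL dF ltac:(lra) NH.
have := bound F f 0 (- h) fL dF ltac:(lra) NH.
rewrite sqrrN /K !ler_norml; move=> /andP[? ?] /andP[? ?] /andP[? ?] /andP[? ?].
lra.
Qed.

End segment.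

(** * The gain of opposite shifts *)

Section shift_gain.
Context (R : realType) (d : nat) (r : R) (r0 : 0 < r).
Variables (f g : 'rV[R]_d -> R).
Implicit Types x y w e : 'rV[R]_d.

(** If [y] is a subgradient of [f] at [x], this is a lower bound for
    [g x - g (x + w) + dotv w y] that does not mention [y]. *)
Definition opposite_shifts x w := g x - g (x + w) + f x - f (x - w).

(** The sum [f x + g x] minus a localized infimal convolution, the infimum over
    [w] of [f (x - w) + g (x + w)]. Unlike the Fenchel-Young gap that it bounds
    from below, it is continuous in [x]. *)
Definition shift_gain x := sup [set opposite_shifts x w | w in cball0 d r].

Hypotheses (fr : elipschitz r f) (gr : elipschitz r g).

Let r_ge0 : 0 <= r. Proof. exact: ltW. Qed.

Let opposite_shifts_le x w : cball0 d r w -> opposite_shifts x w <= 2 * r ^+ 2.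
Proof.
rewrite /cball0/= => wr.
have := fr x (x - w); have := gr x (x + w).
rewrite (_ : x - (x + w) = - w); last by rewrite opprD addrA subrr add0r.
rewrite (_ : x - (x - w) = w); last by rewrite opprB addrC subrK.
rewrite enormN !ler_norml => /andP[_ gw] /andP[_ fw].
have := ler_wpM2l r_ge0 wr; rewrite /opposite_shifts expr2; lra.
Qed.

Let has_sup_shifts x : has_sup [set opposite_shifts x w | w in cball0 d r].
Proof.
split; first by exists (opposite_shifts x 0), 0 => //; exact: cball0_0.
by exists (2 * r ^+ 2) => _ [w wr <-]; exact: opposite_shifts_le.
Qed.

Lemma shift_gain_ub x w : cball0 d r w -> opposite_shifts x w <= shift_gain x.
Proof. by move=> wr; apply: sup_upper_bound => //; exists w. Qed.

Lemma shift_gain_lub x c :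
  (forall w, cball0 d r w -> opposite_shifts x w <= c) -> shift_gain x <= c.
Proof.
by move=> h; apply: ge_sup; [case: (has_sup_shifts x)|move=> _ [w wr <-]; exact: h].
Qed.

Lemma shift_gain_ge0 x : 0 <= shift_gain x.
Proof.
apply: le_trans (shift_gain_ub x (cball0_0 d r_ge0)).
by rewrite /opposite_shifts addr0 subr0 subrr add0r subrr.
Qed.

Lemma shift_gain_le x : shift_gain x <= 2 * r ^+ 2.
Proof. by apply: shift_gain_lub => w; exact: opposite_shifts_le. Qed.

Lemma shift_gain_lipschitz : elipschitz (4 * r) shift_gain.
Proof.
suff H x y : shift_gain x - shift_gain y <= 4 * r * enorm (x - y).
  move=> x y; rewrite ler_norml H lerNl opprB.
  by rewrite (_ : enorm _ = enorm (y - x)) ?H// -enormN opprB.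
rewrite lerBlDr; apply: shift_gain_lub => w wr.
have := shift_gain_ub y wr; rewrite /opposite_shifts.
have := fr x y; have := fr (x - w) (y - w).
have := gr x y; have := gr (x + w) (y + w).
rewrite !opprD !addrA (addrAC x w) addrK.
rewrite (addrAC x (- w)) addrK !ler_norml.
move=> /andP[? ?] /andP[? ?] /andP[? ?] /andP[? ?]; lra.
Qed.

Lemma continuous_shift_gain : continuous shift_gain.
Proof. by apply: elipschitz_continuous shift_gain_lipschitz; rewrite mulr_ge0. Qed.

(** Shifting by [h *: e] for a single [h] along the whole segment bounds the
    integral of the gain below by [h * D - 4 * r ^+ 2 * h ^+ 2], where [D] is the
    variation of [g - f]; the estimate is quadratic in [D] because [h] can be
    taken proportional to [D], sign included. *)
Lemma sqr_variation_le x e : enorm e <= r ->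
  ((((g - f) x - (g - f) (x + e)) ^+ 2)%:E <= (16 * r ^+ 2)%:E *
    \int[lebesgue_measure]_(t in `[0%R, 1%R]) (shift_gain (x + t *: e))%:E)%E.
Proof.
move=> er.
have line_lip k (p : 'rV[R]_d -> R) : 0 <= k -> elipschitz k p ->
    lipschitz1 (k * r) (fun t => p (x + t *: e)).
  move=> k0 pk s t; apply: (le_trans (pk _ _)).
  rewrite opprD addrACA subrr add0r -scalerBl enormZ.
  rewrite (_ : k * r * _ = k * (`|s - t| * r)); last by ring.
  by rewrite !ler_wpM2l.
set D := _ - _.
have rr : 0 < r * r by exact: mulr_gt0.
have Dle : `|D| <= 2 * (r * r).
  have := gr x (x + e); have := fr x (x + e).
  rewrite opprD addrA subrr add0r enormN.
  have := ler_wpM2l r_ge0 er; rewrite /D !fctE/= !ler_norml => ?.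
  by move=> /andP[? ?] /andP[? ?]; apply/andP; split; lra.
(* This [h] maximizes [h * D - 4 * (r * r) * h ^+ 2]. *)
pose h := D / (8 * (r * r)).
have hh : `|h| <= 1 / 2.
  rewrite normrM normfV (gtr0_norm (_ : 0 < 8 * (r * r))) ?mulr_gt0//.
  by rewrite ler_pdivrMr ?mulr_gt0//; lra.
have cG : continuous (fun t : R => shift_gain (x + t *: e)).
  have k4 : 0 <= 4 * r by rewrite mulr_ge0.
  apply: (@lipschitz1_continuous _ (4 * r * r)); first by rewrite mulr_ge0.
  exact: line_lip shift_gain_lipschitz.
have := @integral_opposite_shifts _ (r * r) _ _ _ h (ltW rr)
  (line_lip _ _ r_ge0 fr) (line_lip _ _ r_ge0 gr) cG hh.
rewrite !scale0r !addr0 !scale1r => /(_ _)/wrap[].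
  move=> t; have := @shift_gain_ub (x + t *: e) (h *: e).
  rewrite /opposite_shifts scalerBl scalerDl !addrA; apply.
  rewrite /cball0/= enormZ; apply: le_trans er.
  by rewrite ler_piMl ?enorm_ge0//; lra.
set I := (\int[_]_(_ in _) _)%E => hI.
have r16 : (0 <= (16 * r ^+ 2)%:E)%E by rewrite lee_fin mulr_ge0// sqr_ge0.
apply: le_trans (lee_wpmul2l r16 hI).
rewrite -EFinM lee_fin (_ : g x - f x - _ = D); last by rewrite /D !fctE.
rewrite /h le_eqVlt; apply/orP; left; apply/eqP; field.
by rewrite gt_eqF.
Qed.

End shift_gain.

(** * Support and density bounds *)

Section support.
Context (R : realType) (d : nat) (rho : {measure set 'rV[R]_d -> \bar R}).

Lemma closed_spt : closed (spt rho).
Proof.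
rewrite (_ : spt rho =
    ~` \bigcup_(U in [set U | open U /\ ~ (0 < rho U)%E]) U); last first.
  apply/seteqP; split => x /=.
    by move=> sx [U [oU rU] Ux]; apply: rU; exact: sx.
  by move=> nx U oU Ux; apply: contrapT => rU; apply: nx; exists U.
by apply: open_closedC; apply: bigcup_open => U [].
Qed.

Let rat_ball (p : 'M[rat]_(1, d) * nat) : set 'rV[R]_d :=
  ball (map_mx ratr p.1 : 'rV[R]_d) p.2.+1%:R^-1.

Let rat_ball_basis (U : set 'rV[R]_d) x : open U -> U x ->
  exists2 p, rat_ball p x & rat_ball p `<=` U.
Proof.
move=> oU Ux.
have /nbhs_ballP[e /= e0 xeU] : nbhs x U by exact: open_nbhs_nbhs.
have e20 : 0 < e / 2 by rewrite divr_gt0.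
have [k _ /(_ k (leqnn k))/= kE] := near_infty_natSinv_lt (PosNum e20).
have k0 : 0 < k.+1%:R^-1 :> R by rewrite invr_gt0.
have /choice[q hq] (j : 'I_d) :
    exists q : rat, ball (ratr q : R) k.+1%:R^-1 (x ord0 j).
  have : x ord0 j - k.+1%:R^-1 < x ord0 j + k.+1%:R^-1 by rewrite ltrD2l gtrN.
  move=> /rat_in_itvoo[q]; rewrite in_itv/= => qx; exists q.
  by rewrite -ball_normE/= ltr_distl.
have px : rat_ball (\row_j q j, k) x.
  by split => // i j; rewrite !mxE ord1; exact: hq.
exists (\row_j q j, k) => // y py; apply: xeU; rewrite (splitr e).
apply: (@ball_triangle _ _ (map_mx ratr (\row_j q j) : 'rV[R]_d)).
  exact: le_ball (ltW kE) _ (ball_sym px).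
exact: le_ball (ltW kE) _ py.
Qed.

(** The complement of the support is covered by the null sets among the
    countably many balls with rational centre and inverse integer radius. *)
Lemma setC_spt_null : rho (~` spt rho) = 0%E.
Proof.
have mC : measurable (~` spt rho).
  by apply: measurableC; apply: closed_measurable_mx; exact: closed_spt.
apply/negligibleP => //.
pose F k := if unpickle k is Some p then
  (if rho (rat_ball p) == 0%E then rat_ball p else set0) else set0.
have mball p : measurable (rat_ball p).
  by apply: open_measurable_mx; exact: ball_open.
have Fneg : rho.-negligible (\bigcup_k F k).
  apply: negligible_bigcup => k; rewrite /F; case: unpickle => [p|].
    by case: ifPn => [/eqP p0|_]; [apply/negligibleP|exact: negligible_set0].
  exact: negligible_set0.
apply: negligibleS Fneg => x.
rewrite /setC/= /spt/= => /existsNP[U /not_implyP[oU /not_implyP[Ux rU]]].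
have [p px pU] := rat_ball_basis oU Ux.
exists (pickle p) => //; rewrite /F pickleK ifT//.
rewrite eq_le measure_ge0 andbT.
apply: (@le_trans _ _ (rho U)); last by rewrite leNgt; exact/negP.
by apply: le_measure; rewrite ?inE//; exact: open_measurable_mx.
Qed.

End support.

Section density_bounds.
Context (R : realType) (d : nat) (rho : probability 'rV[R]_d R).
Variables (m M : R).
Hypotheses (m0 : 0 < m) (M0 : 0 < M) (rho_ac : rho `<< lebesgue_rV R d)
  (rho_bounds : {ae lebesgue_rV R d, forall x,
     spt rho x -> (m%:E <= density rho x <= M%:E)%E}).

(** The density is replaced by its positive part, which is nonnegative
    everywhere and not only almost everywhere on the support. *)
Lemma density_bounds_measure B : measurable B -> B `<=` spt rho ->
  (m%:E * lebesgue_rV R d B <= rho B <= M%:E * lebesgue_rV R d B)%E.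
Proof.
move=> mB Bspt.
have ac : charge_of_finite_measure rho `<< lebesgue_rV R d by [].
have mdens : measurable_fun B (density rho).
  apply: measurable_funTS; apply: measurable_int.
  exact: Radon_Nikodym_integrable.
pose D x := maxe 0%E (density rho x).
have mD : measurable_fun B D by exact: measurable_maxe.
have rhoE : rho B = (\int[lebesgue_rV R d]_(x in B) D x)%E.
  transitivity (charge_of_finite_measure rho B); first by [].
  rewrite (Radon_Nikodym_integral ac mB); apply: ae_eq_integral => //.
  apply: filterS rho_bounds => x /= h Bx; apply/esym/max_idPr.
  have /andP[+ _] := h (Bspt _ Bx); apply: le_trans.
  by rewrite lee_fin ltW.
rewrite rhoE -!integral_cst//; apply/andP; split.
- apply: ae_ge0_le_integral => //.
  + by move=> x _; rewrite lee_fin ltW.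
  + by move=> x _; rewrite le_max lexx.
  + apply: filterS rho_bounds => x /= h Bx.
    by have /andP[+ _] := h (Bspt _ Bx); rewrite le_max => ->; rewrite orbT.
- apply: ae_ge0_le_integral => //.
  + by move=> x _; rewrite le_max lexx.
  + by move=> x _; rewrite lee_fin ltW.
  + apply: filterS rho_bounds => x /= h Bx.
    have /andP[h1 h2] := h (Bspt _ Bx); rewrite ge_max h2 andbT.
    by rewrite (le_trans _ (le_trans h1 h2))// lee_fin ltW.
Qed.

End density_bounds.

(** * Homotheties towards a point of a convex piece *)

Section homothety_of_convex_set.
Context (R : realType) (d : nat) (rho : probability 'rV[R]_d R).
Variables (m M : R).
Hypotheses (m0 : 0 < m) (M0 : 0 < M) (rho_ac : rho `<< lebesgue_rV R d)
  (rho_bounds : {ae lebesgue_rV R d, forall x,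
     spt rho x -> (m%:E <= density rho x <= M%:E)%E}).
Variable C : set 'rV[R]_d.
Hypotheses (C_closed : closed C) (C_convex : convex_set C)
  (C_spt : C `<=` spt rho).

Let homothety (t : R) (y x : 'rV[R]_d) := (1 - t) *: x + t *: y.

Let convexC (t : R) x y : 0 <= t <= 1 -> C x -> C y -> C (homothety t y x).
Proof.
move=> /andP[t0 t1] Cx Cy.
have t01 : 0 <= 1 - t <= 1 by rewrite subr_ge0 t1/= gerBl.
have := C_convex (Itv01 (andP t01).1 (andP t01).2) (mem_set Cx) (mem_set Cy).
have -> : homothety t y x = (1 - t) *: x + (1 - (1 - t)) *: y.
  by rewrite /homothety subKr.
by move/set_mem.
Qed.

Let mC : measurable C. Proof. exact: closed_measurable_mx. Qed.

Let mhomothety t y : measurable_fun setT (homothety t y).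
Proof. exact: affine_homothety_measurable. Qed.

Let mpre t y B : measurable B -> measurable (homothety t y @^-1` B).
Proof. by move=> mB; rewrite -[X in measurable X]setTI; exact: mhomothety. Qed.

(** The factor by which a homothety of ratio at least [1 / 2] towards a point of
    a convex piece may increase [rho]-integrals. *)
Definition distortion : R := M * 2 ^+ d / m.

Lemma distortion_ge0 : 0 <= distortion.
Proof. by rewrite divr_ge0 ?mulr_ge0 ?exprn_ge0// ltW. Qed.

Let measure_homothety_le t y B : 0 <= t <= 1 / 2 -> C y -> measurable B ->
  (rho (C `&` homothety t y @^-1` B) <= distortion%:E * rho B)%E.
Proof.
move=> /andP[t0 t2] Cy mB.
have mBC : measurable (B `&` C) by exact: measurableI.
have /andP[_] := density_bounds_measure m0 M0 rho_ac rho_bounds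
  (measurableI _ _ mC (mpre t y mB)) (subset_trans (@subIsetl _ _ _) C_spt).
move/le_trans; apply.
have a0 : 0 < 1 - t by lra.
apply: (@le_trans _ _
    (M%:E * lebesgue_rV R d (homothety t y @^-1` (B `&` C)))%E).
  rewrite lee_pmul2l// le_measure ?inE//.
  - by apply: measurableI => //; exact: mpre.
  - exact: mpre.
  - move=> x [Cx Bx]; split => //; apply: convexC => //; lra.
have := lebesgue_homothety (t *: y) a0 mBC.
have /andP[+ _] := density_bounds_measure m0 M0 rho_ac rho_bounds mBC
  (subset_trans (@subIsetr _ _ _) C_spt).
set V := lebesgue_rV R d (_ @^-1` _) => hm VE.
rewrite {}VE in hm.
have rBC : (rho (B `&` C) <= rho B)%E by apply: le_measure; rewrite ?inE.
have {hm}rBC : (m%:E * (((1 - t) ^+ d)%:E * V) <= rho B)%E by exact: le_trans rBC.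
have dm : (0 <= distortion%:E)%E by rewrite lee_fin distortion_ge0.
apply: le_trans (lee_wpmul2l dm rBC).
rewrite !muleA -!EFinM; apply: lee_wpmul2r; first exact: measure_ge0.
rewrite lee_fin (_ : _ * _ = M * (2 * (1 - t)) ^+ d); last first.
  by rewrite exprMn /distortion; field; rewrite gt_eqF.
have t21 : 1 <= 2 * (1 - t) by lra.
by rewrite ler_peMr ?exprn_ege1// ltW.
Qed.

(** By convexity the homothety maps [C] into [C], where [rho] and Lebesgue measure
    are comparable, and it shrinks volumes by at most the factor [2 ^+ d]. *)
Lemma integral_homothety_le t y (F : 'rV[R]_d -> \bar R) :
  0 <= t <= 1 / 2 -> C y ->
  measurable_fun setT F -> (forall x, 0 <= F x)%E ->
  (\int[rho]_(x in C) F ((1 - t) *: x + t *: y)%R <=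
    distortion%:E * \int[rho]_x F x)%E.
Proof.
move=> t2 Cy mF F0.
have mFS : measurable_fun setT (F \o homothety t y).
  exact: measurableT_comp mF (mhomothety t y).
pose nu1 : {measure set 'rV[R]_d -> \bar R} :=
  scaled_pushforward (NngNum ler01) (mrestr rho mC) (mhomothety t y).
pose k := NngNum distortion_ge0.
rewrite -[leRHS](@ge0_integral_mscale _ _ _ rho _ measurableT k)//.
have nu1E A : nu1 A = rho (homothety t y @^-1` A `&` C) by exact: mul1e.
have le_nu A : measurable A -> (nu1 A <= mscale k rho A)%E.
  by move=> mA; rewrite nu1E setIC; exact: measure_homothety_le.
apply: le_trans (ge0_le_measure_integral le_nu measurableT F0 mF).
rewrite (@eq_measure_integral _ _ _ _ (pushforward (mrestr rho mC) (homothety t y))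
  nu1 F); last by move=> A mA _; rewrite nu1E.
rewrite (ge0_integral_pushforward (mhomothety t y))//.
rewrite preimage_setT.
rewrite (@eq_measure_integral _ _ _ C (mrestr rho mC) rho); last first.
  move=> A mA AC; congr (rho _); apply/seteqP; split => [x Ax|x []//].
  by split => //; exact: AC.
by apply: ge0_subset_integral => // x _; exact: F0.
Qed.

End homothety_of_convex_set.

(** * Tonelli's theorem on subsets and mean values *)

Section integral_on_sets.
Local Open Scope ereal_scope.

Section tonelli.
Context d1 d2 (T1 : measurableType d1) (T2 : measurableType d2) (R : realType).
Variables (m1 : {sigma_finite_measure set T1 -> \bar R})
  (m2 : {sigma_finite_measure set T2 -> \bar R}).
Variables (F : T1 -> T2 -> \bar R) (A : set T1) (B : set T2).
Hypotheses (mA : measurable A) (mB : measurable B)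
  (mF : measurable_fun setT (fun p => F p.1 p.2)) (F0 : forall x y, 0 <= F x y).

Let FAB := (fun p : T1 * T2 => F p.1 p.2) \_ (A `*` B).

Let mFAB : measurable_fun setT FAB.
Proof.
by apply/measurable_restrict => //;
  [exact: measurableX|exact: measurable_funTS].
Qed.

Let FAB0 p : 0 <= FAB p.
Proof. by rewrite /FAB patchE; case: ifPn. Qed.

Let inner2 : (fun x => \int[m2]_(y in B) F x y) \_ A =
  (fun x => \int[m2]_y FAB (x, y)).
Proof.
apply/funext => x; rewrite patchE; case: ifPn => xA.
  rewrite integral_mkcond; apply: eq_integral => y _.
  by rewrite /FAB !patchE in_setX xA.
rewrite integral0_eq// => y _.
by rewrite /FAB patchE in_setX (negbTE xA).
Qed.

Let inner1 : (fun y => \int[m1]_(x in A) F x y) \_ B =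
  (fun y => \int[m1]_x FAB (x, y)).
Proof.
apply/funext => y; rewrite patchE; case: ifPn => yB.
  rewrite integral_mkcond; apply: eq_integral => x _.
  by rewrite /FAB !patchE in_setX yB andbT.
rewrite integral0_eq// => x _.
by rewrite /FAB patchE in_setX (negbTE yB) andbF.
Qed.

Lemma tonelli_on : \int[m1]_(x in A) \int[m2]_(y in B) F x y =
  \int[m2]_(y in B) \int[m1]_(x in A) F x y.
Proof.
by rewrite integral_mkcond inner2 [RHS]integral_mkcond inner1 (fubini_tonelli FAB).
Qed.

Lemma measurable_inner_integral :
  measurable_fun A (fun x => \int[m2]_(y in B) F x y).
Proof.
apply/(measurable_restrictT _ mA); rewrite inner2.
exact: (measurable_fun_fubini_tonelli_F FAB).
Qed.

End tonelli.

(** If [q] were above [b] on all of [A], the nonnegative function [q - b] would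
    have a nonpositive integral, hence vanish almost everywhere on [A]. *)
Lemma exists_le_mean d (T : measurableType d) (R : realType)
    (mu : {measure set T -> \bar R}) (A : set T) (q : T -> \bar R) (b : R) :
  measurable A -> 0 < mu A -> mu A < +oo -> measurable_fun A q ->
  (forall x, A x -> 0 <= q x) -> (0 <= b)%R ->
  \int[mu]_(x in A) q x <= b%:E * mu A ->
  exists2 x, A x & q x <= b%:E.
Proof.
move=> mA A0 Aoo mq q0 b0 qb; apply: contrapT => nq.
have bq x : A x -> b%:E < q x.
  by move=> Ax; rewrite ltNge; apply/negP => qx; apply: nq; exists x.
have bAoo : b%:E * mu A < +oo by rewrite lte_mul_pinfty.
have iq : mu.-integrable A q.
  apply/integrableP; split => //; apply: le_lt_trans bAoo; apply: le_trans qb.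
  by rewrite le_eqVlt; apply/orP; left; apply/eqP; apply: eq_integral => x /[!inE] Ax;
    rewrite gee0_abs// q0.
have ib : mu.-integrable A (cst b%:E).
  apply/integrableP; split => //; under eq_integral do rewrite /= ger0_norm//.
  by rewrite integral_cst.
have : \int[mu]_(x in A) `|q x - b%:E| = 0.
  apply/eqP; rewrite eq_le integral_ge0 ?andbT//.
  under eq_integral => x /[!inE] Ax.
    rewrite gee0_abs; last by rewrite sube_ge0// ltW// bq.
    over.
  rewrite integralB// integral_cst//.
  by rewrite sube_le0.
move/(ae_eq_integral_abs mu mA) => /(_ _)[|N [mN N0 AN]].
  by apply: emeasurable_funB.
have : mu A <= mu N.
  apply: le_measure; rewrite ?inE// => x Ax; apply: AN => /= /(_ Ax).
  have := bq _ Ax; case: (q x) => [s| |]//=; rewrite lte_fin -EFinB => bs [].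
  by move/eqP; rewrite subr_eq0 gt_eqF.
by rewrite N0 leNgt A0.
Qed.

End integral_on_sets.

(** * Poincare inequality on a convex piece *)

(** The bound on the inner integral is only available in the first variable of
    [H]; Tonelli's theorem gives the same bound for the transposed term. *)
Lemma double_integral_le d (T : measurableType d) (R : realType)
    (mu : probability T R) (A : set T) (D H : T -> T -> \bar R)
    (c : R) (b : \bar R) : measurable A ->
  measurable_fun setT (fun p : T * T => D p.1 p.2) ->
  measurable_fun setT (fun p : T * T => H p.1 p.2) ->
  (forall x y, 0 <= D x y)%E -> (forall x y, 0 <= H x y)%E ->
  0 <= c -> (0 <= b)%E ->
  (forall x y, A x -> A y -> D x y <= c%:E * (H x y + H y x))%E ->
  (forall y, A y -> \int[mu]_(x in A) H x y <= b)%E ->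
  (\int[mu]_(y in A) \int[mu]_(x in A) D x y <=
    c%:E * (b * mu A + b * mu A))%E.
Proof.
move=> mA mD mH D0 H0 c0 b0 DH Hb.
have mDs : measurable_fun setT (fun p : T * T => D p.2 p.1).
  exact: (measurableT_comp mD (@measurable_swap _ _ _ _)).
have mHs : measurable_fun setT (fun p : T * T => H p.2 p.1).
  exact: (measurableT_comp mH (@measurable_swap _ _ _ _)).
have mDy y : measurable_fun A (fun x => D x y).
  exact: measurable_funTS (measurableT_comp mD (measurable_pair2 y)).
have mHy y : measurable_fun A (fun x => H x y).
  exact: measurable_funTS (measurableT_comp mH (measurable_pair2 y)).
have mHx x : measurable_fun A (fun y => H x y).
  exact: measurable_funTS (measurableT_comp mH (measurable_pair1 x)).
pose I y := (\int[mu]_(x in A) H x y)%E.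
pose I' y := (\int[mu]_(x in A) H y x)%E.
have mI : measurable_fun A I.
  exact: (measurable_inner_integral mu mA mA mHs (fun x y => H0 y x)).
have mI' : measurable_fun A I'.
  exact: (measurable_inner_integral mu mA mA mH H0).
have I0 y : (0 <= I y)%E by exact: integral_ge0.
have I0' y : (0 <= I' y)%E by exact: integral_ge0.
have inner y : A y ->
    (\int[mu]_(x in A) D x y <= c%:E * (I y + I' y))%E.
  move=> Ay.
  have <- : (\int[mu]_(x in A) (c%:E * (H x y + H y x)) = c%:E * (I y + I' y))%E.
    rewrite ge0_integralZl_EFin//.
    - by rewrite ge0_integralD.
    - by move=> x _; rewrite adde_ge0.
    - exact: emeasurable_funD.
  apply: ge0_le_integral => //.
  - by apply: measurable_funeM; exact: emeasurable_funD.
  - by move=> x Ax; exact: DH.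
have Ib : (\int[mu]_(y in A) I y <= b * mu A)%E.
  by rewrite -integral_cst//; apply: ge0_le_integral.
have Ib' : (\int[mu]_(y in A) I' y <= b * mu A)%E.
  by rewrite (tonelli_on mu mu mA mA mH H0).
apply: (@le_trans _ _ (\int[mu]_(y in A) (c%:E * (I y + I' y)))%E).
  apply: ge0_le_integral => //.
  - by move=> y _; exact: integral_ge0.
  - exact: (measurable_inner_integral mu mA mA mDs (fun x y => D0 y x)).
  - by apply: measurable_funeM; exact: emeasurable_funD.
rewrite ge0_integralZl_EFin//.
- by rewrite ge0_integralD// lee_wpmul2l ?leeD// lee_fin.
- by move=> y _; rewrite adde_ge0.
- exact: emeasurable_funD.
Qed.

Section poincare_convex.
Context (R : realType) (d : nat) (r : R) (r0 : 0 < r)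
  (rho : probability 'rV[R]_d R).
Variables (m M : R).
Hypotheses (m0 : 0 < m) (M0 : 0 < M) (rho_ac : rho `<< lebesgue_rV R d)
  (rho_bounds : {ae lebesgue_rV R d, forall x,
     spt rho x -> (m%:E <= density rho x <= M%:E)%E}).
Variable C : set 'rV[R]_d.
Hypotheses (C_closed : closed C) (C_convex : convex_set C)
  (C_spt : C `<=` spt rho) (C_ball : C `<=` cball0 d r).
Variables (f g : 'rV[R]_d -> R).
Hypotheses (fr : elipschitz r f) (gr : elipschitz r g).

Local Notation G := (shift_gain r f g).
Local Notation u := (g - f).
Local Notation K := (distortion d m M).
Local Open Scope ereal_scope.

Let J := \int[rho]_x (G x)%:E.

Let mC : measurable C. Proof. exact: closed_measurable_mx. Qed.

Let mG : measurable_fun setT (EFin \o G).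
Proof.
apply/measurable_EFinP; apply: continuous_measurable_mx.
exact: continuous_shift_gain.
Qed.

Let G0 x : 0 <= (G x)%:E. Proof. by rewrite lee_fin shift_gain_ge0. Qed.

(** The segment from [x] to [y] is only run up to its midpoint, so that the
    homotheties involved have ratio at least [1 / 2]; the other half is run
    from [y]. *)
Let point (x y : 'rV[R]_d) (t : R) := ((1 - t / 2) *: x + (t / 2) *: y)%R.

Let mpoint d1 (T : measurableType d1) (X Y : T -> 'rV[R]_d) (t : T -> R) :
  measurable_fun setT X -> measurable_fun setT Y -> measurable_fun setT t ->
  measurable_fun setT (fun z => point (X z) (Y z) (t z)).
Proof.
move=> mX mY mt; apply: measurable_fun_mx => i j.
rewrite (_ : (fun _ => _) = (fun z =>
    (1 - t z / 2) * X z i j + (t z / 2) * Y z i j)%R); last first.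
  by apply/funext => z; rewrite /point !mxE.
have mt2 : measurable_fun setT (fun z => t z / 2)%R by exact: measurable_funM.
apply: measurable_funD; apply: measurable_funM => //.
- exact: measurable_funB.
- exact: measurableT_comp (measurable_coord i j) mX.
- exact: measurableT_comp (measurable_coord i j) mY.
Qed.

Let H x y := \int[lebesgue_measure]_(t in `[0%R, 1%R]) (G (point x y t))%:E.

Let H0 x y : 0 <= H x y. Proof. exact: integral_ge0. Qed.

Let mH : measurable_fun setT (fun p : 'rV[R]_d * 'rV[R]_d => H p.1 p.2).
Proof.
pose F (p : 'rV[R]_d * 'rV[R]_d) (t : measurableTypeR R) :=
  (G (point p.1 p.2 t))%:E.
have mF : measurable_fun setT (fun q => F q.1 q.2).
  apply: (measurableT_comp mG).
  apply: mpoint; last exact: measurable_snd.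
    exact: measurableT_comp measurable_fst measurable_fst.
  exact: measurableT_comp measurable_snd measurable_fst.
exact: (@measurable_inner_integral _ _ _ _ R lebesgue_measure F setT
  `[0%R, 1%R] measurableT (measurable_itv _) mF (fun p t => G0 _)).
Qed.

Let integral_H_le y : C y -> \int[rho]_(x in C) H x y <= K%:E * J.
Proof.
move=> Cy.
pose F x (t : measurableTypeR R) := (G (point x y t))%:E.
have mF : measurable_fun setT (fun q => F q.1 q.2).
  apply: (measurableT_comp mG).
  by apply: mpoint; [exact: measurable_fst|exact: measurable_cst|exact: measurable_snd].
have F0 x t : 0 <= F x t by exact: G0.
rewrite /H (@tonelli_on _ _ _ _ R rho lebesgue_measure F C `[0%R, 1%R])//.
have KJ0 : 0 <= K%:E * J.
  by rewrite mule_ge0 ?integral_ge0// lee_fin distortion_ge0.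
apply: (@le_trans _ _
    (\int[lebesgue_measure]_(t in `[0%R, 1%R]) cst (K%:E * J) t)).
  apply: ge0_le_integral => //.
  - by move=> t _; exact: integral_ge0.
  - apply: (@measurable_inner_integral _ _ _ _ R rho (fun t x => F x t)) => //.
    exact: (measurableT_comp mF (@measurable_swap _ _ _ _)).
  - move=> t; rewrite /= in_itv/= => /andP[t0 t1].
    apply: (integral_homothety_le m0 M0 rho_ac rho_bounds C_closed C_convex
      C_spt) => //; apply/andP; split; lra.
have l01 : lebesgue_measure (`[0%R, 1%R] : set R) = 1.
  by rewrite lebesgue_measure_itv/= lte_fin ltr01 oppr0 adde0.
by rewrite integral_cst// [X in _ * X]l01 mule1.
Qed.

Let sqr_le_H x y : C x -> C y ->
  (((u x - u y) ^+ 2)%R)%:E <= (32 * r ^+ 2)%:E * (H x y + H y x).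
Proof.
move=> Cx Cy.
have half a b : C a -> C b -> (enorm (2^-1 *: (b - a))%R <= r)%R.
  move=> Ca Cb; rewrite enormZ ger0_norm ?invr_ge0//.
  have := enormD b (- a); rewrite enormN.
  have := C_ball Ca; have := C_ball Cb; rewrite /cball0/=; lra.
have pointE a b t : (a + t *: (2^-1 *: (b - a)))%R = point a b t.
  by rewrite /point; apply/rowP => i; rewrite !mxE; ring.
have := sqr_variation_le r0 fr gr x (half _ _ Cx Cy).
have := sqr_variation_le r0 fr gr y (half _ _ Cy Cx).
under eq_integral do rewrite pointE; rewrite -/(H y x) => yx.
under eq_integral do rewrite pointE; rewrite -/(H x y) => xy.
have mid : (y + 2^-1 *: (x - y) = x + 2^-1 *: (y - x))%R.
  apply/rowP => i; rewrite !mxE; lra.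
rewrite mid in yx; set z := (x + _)%R in xy yx.
have := leeD xy yx; rewrite -ge0_muleDr// => h.
rewrite (_ : 32 * r ^+ 2 = 2 * (16 * r ^+ 2))%R; last by ring.
have two0 : (0 : \bar R) <= 2%:E by rewrite lee_fin.
rewrite (EFinM 2) -muleA; apply: le_trans (lee_wpmul2l two0 h).
rewrite -EFinD -EFinM lee_fin.
have := sqr_ge0 ((u x - u z) + (u y - u z))%R.
rewrite !expr2; lra.
Qed.

Let mu_ : measurable_fun setT u.
Proof.
have cf := elipschitz_continuous (ltW r0) fr.
have cg := elipschitz_continuous (ltW r0) gr.
by apply: measurable_funB; exact: continuous_measurable_mx.
Qed.

(** The square variation of [g - f] between two points of [C] is bounded by the
    integral of the gain along the segment that joins them. In the average over
    the pairs of end points, the segments cover [C] with bounded multiplicity,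
    and some end point [y] does at least as well as the average; [a] is the
    value of [g - f] there. *)
Lemma poincare_convex : 0 < rho C ->
  exists a, \int[rho]_(x in C) (((u x - a) ^+ 2)%R)%:E <=
    (64 * r ^+ 2 * K)%:E * J.
Proof.
move=> C0; pose D x y := (((u x - u y) ^+ 2)%R)%:E.
have mD : measurable_fun setT (fun p : 'rV[R]_d * 'rV[R]_d => D p.1 p.2).
  apply/measurable_EFinP; apply: measurable_funX; apply: measurable_funB.
    exact: measurableT_comp mu_ measurable_fst.
  exact: measurableT_comp mu_ measurable_snd.
have D0 x y : 0 <= D x y by rewrite lee_fin sqr_ge0.
have J0 : 0 <= J by exact: integral_ge0.
have Joo : J < +oo.
  apply: (@le_lt_trans _ _ (\int[rho]_x cst (2 * r ^+ 2)%:E x)).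
    apply: ge0_le_integral => // x _; rewrite lee_fin.
    exact: shift_gain_le.
  by rewrite integral_cst//= probability_setT mule1 ltry.
have Jfin : J \is a fin_num by rewrite ge0_fin_numE.
have Coo : rho C < +oo.
  by apply: le_lt_trans (ltry 1); exact: probability_le1.
have Cfin : rho C \is a fin_num by rewrite ge0_fin_numE.
have K0 : (0 <= K)%R by exact: distortion_ge0.
have r2 : (0 <= 32 * r ^+ 2)%R by rewrite mulr_ge0// sqr_ge0.
pose b := (64 * r ^+ 2 * K * fine J)%R.
have b0 : (0 <= b)%R.
  apply: mulr_ge0; last exact: fine_ge0.
  by apply: mulr_ge0 => //; apply: mulr_ge0 => //; exact: sqr_ge0.
have KJ0 : 0 <= K%:E * J by rewrite mule_ge0// lee_fin.
have mean : \int[rho]_(y in C) \int[rho]_(x in C) D x y <= b%:E * rho C.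
  have := double_integral_le mC mD mH D0 H0 r2 KJ0 sqr_le_H integral_H_le.
  move/le_trans; apply; rewrite le_eqVlt; apply/orP; left; apply/eqP.
  rewrite -(fineK Cfin) -(fineK Jfin) -!EFinM; congr EFin.
  by rewrite /b; ring.
have mDs : measurable_fun setT (fun p : 'rV[R]_d * 'rV[R]_d => D p.2 p.1).
  exact: (measurableT_comp mD (@measurable_swap _ _ _ _)).
have [y Cy hy] := exists_le_mean mC C0 Coo
  (measurable_inner_integral rho mC mC mDs (fun x y => D0 y x))
  (fun y _ => integral_ge0 _ (fun x _ => D0 x y)) b0 mean.
by exists (u y); apply: (le_trans hy); rewrite /b EFinM fineK.
Qed.

End poincare_convex.

(** * Chaining the pieces *)

Section chaining.
Context (R : realType) (d : nat) (mu : probability 'rV[R]_d R).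
Context (N : nat) (C : 'I_N -> set 'rV[R]_d).
Variable P : ('rV[R]_d -> R) -> \bar R -> Prop.
Hypotheses (C_closed : forall i, closed (C i))
  (P_measurable : forall u J, P u J -> measurable_fun setT u)
  (P_ge0 : forall u J, P u J -> (0 <= J)%E).
Implicit Types (S : {set 'I_N}) (A B : set 'rV[R]_d) (a b : R).
Local Open Scope ereal_scope.

Let sqdev (u : 'rV[R]_d -> R) a A := \int[mu]_(x in A) (((u x - a) ^+ 2)%R)%:E.

(** The constant [a] may depend on the function [u] but not on the piece, and [c]
    depends on neither. *)
Definition common_deviation S := exists2 c : R, (0 <= c)%R &
  forall u J, P u J -> exists a, forall i, i \in S -> sqdev u a (C i) <= c%:E * J.

Let mC i : measurable (C i). Proof. exact: closed_measurable_mx. Qed.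

Let msq u J a : P u J ->
  measurable_fun setT (fun x => (((u x - a) ^+ 2)%R)%:E).
Proof.
move=> /P_measurable mu_; apply/measurable_EFinP; apply: measurable_funX.
by apply: measurable_funB.
Qed.

Let sq0 u a (x : 'rV[R]_d) : 0 <= (((u x - a) ^+ 2)%R)%:E.
Proof. by rewrite lee_fin sqr_ge0. Qed.

Let sqdev_shift u J a b A : P u J -> measurable A ->
  sqdev u a A <= 2%:E * sqdev u b A + (2 * (a - b) ^+ 2)%:E * mu A.
Proof.
move=> PuJ mA; have mb := msq b PuJ; have ma := msq a PuJ.
rewrite /sqdev -ge0_integralZl_EFin//; last exact: measurable_funTS.
rewrite -integral_cst// -ge0_integralD//; last 3 first.
- by move=> x _; rewrite mule_ge0.
- by apply: measurable_funeM; exact: measurable_funTS.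
- by move=> x _; rewrite lee_fin mulr_ge0// sqr_ge0.
apply: ge0_le_integral => //.
- exact: measurable_funTS.
- by apply: emeasurable_funD => //; apply: measurable_funeM; exact: measurable_funTS.
move=> x _; rewrite -EFinM -EFinD lee_fin.
have := sqr_ge0 ((u x - b) - (b - a))%R; rewrite !expr2; lra.
Qed.

Let sqdev_cst_le u J a b A : P u J -> measurable A ->
  ((a - b) ^+ 2)%:E * mu A <= 2%:E * (sqdev u a A + sqdev u b A).
Proof.
move=> PuJ mA; have mb := msq b PuJ; have ma := msq a PuJ.
rewrite /sqdev -ge0_integralD//; try exact: measurable_funTS.
rewrite -ge0_integralZl_EFin//; last 2 first.
- by move=> x _; rewrite adde_ge0.
- by apply: emeasurable_funD; exact: measurable_funTS.
rewrite -integral_cst//; apply: ge0_le_integral => //.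
- by move=> x _; exact: sq0.
- apply: measurable_funeM; apply: emeasurable_funD; exact: measurable_funTS.
move=> x _; rewrite -EFinD -EFinM lee_fin.
have := sqr_ge0 ((u x - a) + (u x - b))%R; rewrite !expr2; lra.
Qed.

Let sqdevS u J a A B : P u J -> measurable A -> measurable B -> A `<=` B ->
  sqdev u a A <= sqdev u a B.
Proof.
move=> PuJ mA mB; apply: ge0_subset_integral => //.
exact: measurable_funTS (msq a PuJ).
Qed.

Lemma common_deviation_null S j : mu (C j) = 0 -> common_deviation S ->
  common_deviation (j |: S).
Proof.
move=> Cj0 [c c0 hS]; exists c => // u J PuJ; have [a ha] := hS _ _ PuJ.
exists a => i; rewrite !inE => /predU1P[->|]; last exact: ha.
have -> : sqdev u a (C j) = 0.
  by apply: null_set_integral => //; exact: measurable_funTS (msq a PuJ).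
by rewrite mule_ge0 ?lee_fin// (P_ge0 PuJ).
Qed.

(** If [u] is close to [a] on [C i] and to [b] on [C j], then [a] is close to [b]
    because both approximate [u] on the overlap, which has positive measure. *)
Lemma common_deviation_overlap S i j : i \in S -> 0 < mu (C i `&` C j) ->
  common_deviation [set j] -> common_deviation S ->
  common_deviation (j |: S).
Proof.
move=> iS Cij [c' c'0 hj] [c c0 hS].
have mCij : measurable (C i `&` C j) by exact: measurableI.
have le1 A : measurable A -> mu A <= 1 by exact: probability_le1.
have finA A : measurable A -> mu A \is a fin_num.
  by move=> mA; rewrite ge0_fin_numE// (le_lt_trans (le1 _ mA))// ltry.
set k := fine (mu (C i `&` C j)).
have k0 : (0 < k)%R by rewrite fine_gt0// Cij/= -ge0_fin_numE// finA.
pose c1 := (c + (2 * c' + 4 * ((c + c') / k)))%R.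
have ck0 : (0 <= (c + c') / k)%R by rewrite divr_ge0 ?addr_ge0// ltW.
have c20 : (0 <= 2 * c' + 4 * ((c + c') / k))%R.
  by apply: addr_ge0; exact: mulr_ge0.
exists c1; first exact: addr_ge0.
move=> u J PuJ; have J0 := P_ge0 PuJ.
have [a ha] := hS _ _ PuJ; have [b hb] := hj _ _ PuJ.
have {}hb := hb j (set11 j).
exists a => l; rewrite !inE => /predU1P[->|lS]; last first.
  by apply: (le_trans (ha _ lS)); rewrite lee_wpmul2r// lee_fin lerDl.
have ab : ((a - b) ^+ 2)%:E <= (2 * ((c + c') / k))%:E * J.
  have h1 : ((a - b) ^+ 2)%:E * k%:E <= (2 * (c + c'))%:E * J.
    rewrite /k fineK ?finA//; apply: (le_trans (sqdev_cst_le a b PuJ mCij)).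
    rewrite EFinM -muleA; apply: lee_wpmul2l; first by rewrite lee_fin.
    rewrite EFinD ge0_muleDl ?lee_fin//; apply: leeD.
      apply: le_trans (ha _ iS).
      exact: (sqdevS a PuJ mCij (mC i) (@subIsetl _ _ _)).
    apply: le_trans hb.
    exact: (sqdevS b PuJ mCij (mC j) (@subIsetr _ _ _)).
  by rewrite mulrA (EFinM (2 * (c + c'))%R) muleAC lee_pdivlMr.
apply: (le_trans (sqdev_shift a b PuJ (mC j))).
apply: (@le_trans _ _ (2%:E * (c'%:E * J) + 2%:E * ((2 * ((c + c') / k))%:E * J))).
  apply: leeD; first by apply: lee_wpmul2l => //; rewrite lee_fin.
  apply: (@le_trans _ _ ((2 * (a - b) ^+ 2)%:E)).
    rewrite -[leRHS]mule1; apply: lee_wpmul2l; last exact: le1 (mC j).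
    by rewrite lee_fin; apply: mulr_ge0 => //; exact: sqr_ge0.
  by rewrite EFinM lee_wpmul2l ?lee_fin.
rewrite !muleA -!EFinM -ge0_muleDl ?lee_fin; first last.
- by apply: mulr_ge0 => //; exact: mulr_ge0.
- exact: mulr_ge0.
rewrite lee_wpmul2r// -EFinD lee_fin /c1.
rewrite (_ : 2 * (2 * _) = 4 * ((c + c') / k))%R; last by ring.
by rewrite lerDr.
Qed.

(** A maximal [S] leaves no piece out: otherwise the pieces inside and outside
    of [S] would disconnect their union. *)
Lemma common_deviation_setT i0 :
  (forall i, 0 < mu (C i) -> common_deviation [set i]) ->
  0 < mu (C i0) ->
  connected (\bigcup_(i in [set: 'I_N]) C i) ->
  (forall i j, i != j -> C i `&` C j !=set0 -> 0 < mu (C i `&` C j)) ->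
  common_deviation [set: 'I_N]%SET.
Proof.
move=> base Ci0 conn overlap.
pose good S := (i0 \in S) && `[< common_deviation S >].
have h0 : good [set i0]%SET by rewrite /good set11; apply/asboolP; exact: base.
have [S /andP[i0S /asboolP devS] maxS] :=
  arg_maxnP (fun S : {set 'I_N} => #|S|) h0.
have grow j : common_deviation (j |: S) -> j \in S.
  move=> /asboolP devjS; have := maxS (j |: S)%SET.
  rewrite /good !inE i0S orbT devjS => /(_ isT); rewrite cardsU1.
  by case: (j \in S) => //=; rewrite add1n ltnn.
have pos j : j \notin S -> 0 < mu (C j).
  move=> jS; rewrite lt0e measure_ge0 andbT; apply: contra jS => /eqP Cj0.
  by apply: grow; exact: common_deviation_null.
have disj i j : i \in S -> j \notin S -> C i `&` C j = set0.
  move=> iS jS; apply: contrapT => /eqP/set0P ne.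
  have ij : i != j by apply: contraNneq jS => <-.
  move/negP: (jS); apply; apply: grow.
  exact: common_deviation_overlap iS (overlap _ _ ij ne) (base _ (pos _ jS)) devS.
have nempty j : 0 < mu (C j) -> C j !=set0.
  move=> Cj; apply/set0P/negP => /eqP Cj0; move: Cj; rewrite Cj0 measure0 ltxx.
  by [].
suff -> : [set: 'I_N]%SET = S by [].
pose B (Q : {set 'I_N}) := \bigcup_(i in [set i | i \in Q]) C i.
have closedB Q : closed (B Q).
  by apply: closed_bigcup => //; exact: finite_finset.
have BS : B S = \bigcup_(i in [set: 'I_N]) C i.
  apply: conn.
  - by have [x Cx] := nempty _ Ci0; exists x, i0.
  - exists (~` B (finset.setC S)); first exact: closed_openC.
    apply/seteqP; split=> [x [i /= iS Cix]|x [[i _ Cix] nx]].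
      split; first by exists i.
      move=> [j /=]; rewrite inE => jS Cjx.
      have : (C i `&` C j) x by [].
      by rewrite disj.
    exists i => //=; apply: contrapT => /negP iS; apply: nx.
    by exists i => //=; rewrite inE.
  - exists (B S) => //; apply/seteqP; split=> [x [i iS Cix]|x []//].
    by split; exists i.
apply/setP => j; rewrite !inE; apply/esym; apply: contrapT => /negP jS.
have [x Cx] := nempty _ (pos _ jS).
have : B S x by rewrite BS; exists j.
move=> [i /= iS Cix].
have : (C i `&` C j) x by [].
by rewrite disj.
Qed.

End chaining.

(** * Conjugates and subgradients *)

Definition subgradient (R : realType) (d : nat) (f : 'rV[R]_d -> R)
    (x y : 'rV[R]_d) := forall z, f x + dotv (z - x) y <= f z.

Section conjugate.
Context (R : realType) (d : nat) (r : R) (r0 : 0 < r) (psi : 'rV[R]_d -> R).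
Hypothesis psi_continuous : {within cball0 d r, continuous psi}.
Local Notation phi := (conjugate (cball0 d r) psi).
Implicit Types x y z : 'rV[R]_d.

Lemma dotv_lipschitz y : elipschitz (enorm y) (fun x => dotv x y).
Proof. by move=> x z; rewrite -dotvBl mulrC dotv_le. Qed.

Let attained x : exists2 y, cball0 d r y &
  forall z, cball0 d r z -> dotv x z - psi z <= dotv x y - psi y.
Proof.
have c0 : @cball0 R d r !=set0 by exists 0; apply: cball0_0; exact: ltW.
have cont : {within cball0 d r, continuous (fun y => dotv x y - psi y)}.
  move=> y; apply: continuousB; last exact: psi_continuous.
  apply: continuous_subspaceT => {}y.
  rewrite (_ : dotv x = fun z => dotv z x); last by apply/funext => z; rewrite dotvC.
  exact: (elipschitz_continuous (enorm_ge0 x) (@dotv_lipschitz x)).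
have [y yr ymax] := compact_EVT_max c0 (@compact_cball0 R d r) cont.
by exists y; [exact: set_mem|move=> z zr; apply: ymax; exact: mem_set].
Qed.

Lemma conjugate_attained x :
  exists2 y, cball0 d r y & phi x = dotv x y - psi y.
Proof.
have [y yr ymax] := attained x; exists y => //.
apply/eqP; rewrite eq_le; apply/andP; split.
  apply: ge_sup; first by exists (dotv x y - psi y), y.
  by move=> _ [z zr <-]; exact: ymax.
apply: ub_le_sup; last by exists y.
by exists (dotv x y - psi y) => _ [z zr <-]; exact: ymax.
Qed.

Lemma conjugate_ub x y : cball0 d r y -> dotv x y - psi y <= phi x.
Proof.
move=> yr; apply: ub_le_sup; last by exists y.
have [z _ zmax] := attained x.
by exists (dotv x z - psi z) => _ [w wr <-]; exact: zmax.
Qed.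

Lemma maximizer_subgradient x y : cball0 d r y -> phi x = dotv x y - psi y ->
  subgradient phi x y.
Proof.
move=> yr phix z; rewrite phix dotvBl; have := conjugate_ub z yr; lra.
Qed.

Lemma conjugate_lipschitz : elipschitz r phi.
Proof.
suff H x z : phi x - phi z <= r * enorm (x - z).
  move=> x z; rewrite ler_norml H lerNl opprB.
  by rewrite (_ : enorm _ = enorm (z - x)) ?H// -enormN opprB.
have [y yr phix] := conjugate_attained x.
have := maximizer_subgradient yr phix z.
have := dotv_le (z - x) y; rewrite ler_norml => /andP[+ _].
rewrite -enormN opprB.
have : enorm (x - z) * enorm y <= r * enorm (x - z).
  by rewrite mulrC ler_wpM2r// enorm_ge0.
lra.
Qed.

End conjugate.

(** The Fenchel-Young gap at [y] bounds the gain of all opposite shifts,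
    because [y] is a subgradient of the first conjugate at [x]. *)
Lemma fenchel_gap_ge (R : realType) (d : nat) (r : R)
    (psi psit : 'rV[R]_d -> R) (x y w : 'rV[R]_d) : 0 < r ->
  {within cball0 d r, continuous psi} ->
  {within cball0 d r, continuous psit} ->
  cball0 d r y -> conjugate (cball0 d r) psi x = dotv x y - psi y ->
  opposite_shifts (conjugate (cball0 d r) psi) (conjugate (cball0 d r) psit) x w
  <= conjugate (cball0 d r) psit x - conjugate (cball0 d r) psi x
    - (psi y - psit y).
Proof.
move=> r0 cpsi cpsit yr phix.
have := conjugate_ub r0 cpsit (x + w) yr; have := conjugate_ub r0 cpsi (x - w) yr.
rewrite /opposite_shifts dotvBl dotvDl phix; lra.
Qed.

(** * Directional derivatives of convex functions *)

Section directional_derivative.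
Context (R : realType) (d : nat) (r : R) (r0 : 0 < r) (f : 'rV[R]_d -> R).
Hypotheses (fr : elipschitz r f) (f_sub : forall x, exists y, subgradient f x y).
Variable e : 'rV[R]_d.
Implicit Types (x y : 'rV[R]_d) (h : R) (n k : nat).

(** For convex [f] this is nonnegative, and its infimum over [n] is zero exactly
    where [f] is derivable in the direction [e]. *)
Definition slope_jump n x : R :=
  n.+1%:R * (f (x + n.+1%:R^-1 *: e) + f (x - n.+1%:R^-1 *: e) - 2 * f x).

Let addKx x y : x + y - x = y. Proof. by rewrite addrAC subrr add0r. Qed.

Let addBx x y : x - (x + y) = - y. Proof. by rewrite opprD addrA subrr add0r. Qed.

Lemma slope_jump_ge0 n x : 0 <= slope_jump n x.
Proof.
rewrite mulr_ge0//; have [y fy] := f_sub x.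
have := fy (x + n.+1%:R^-1 *: e); have := fy (x - n.+1%:R^-1 *: e).
rewrite !addKx -scaleNr !dotvZl mulNr; move: (_ * dotv e y) => D; lra.
Qed.

Lemma measurable_slope_jump n : measurable_fun setT (slope_jump n).
Proof.
have mf : measurable_fun setT f.
  by apply: continuous_measurable_mx; exact: elipschitz_continuous (ltW r0) fr.
have mshift (a : R) : measurable_fun setT (fun x => f (x + a *: e)).
  apply: (measurableT_comp mf).
  have := @affine_homothety_measurable R d 1 (a *: e).
  by congr (measurable_fun _ _); apply/funext => x; rewrite scale1r.
apply: measurable_funM => //; apply: measurable_funB; last exact: measurable_funM.
apply: measurable_funD; first exact: mshift.
have := mshift (- n.+1%:R^-1).
by congr (measurable_fun _ _); apply/funext => x; rewrite scaleNr.
Qed.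

(** Both sides compare the slopes of [f] on nested segments from [x]. *)
Let slope_le x h h' : 0 < h -> h <= h' ->
  h' * (f (x + h *: e) - f x) <= h * (f (x + h' *: e) - f x) /\
  h' * (f (x - h *: e) - f x) <= h * (f (x - h' *: e) - f x).
Proof.
move=> h0 hh'.
suff H v : h' * (f (x + h *: v) - f x) <= h * (f (x + h' *: v) - f x).
  by split; [exact: H|have := H (- e); rewrite !scalerN].
have [y fy] := f_sub (x + h *: v).
have := fy x; have := fy (x + h' *: v).
rewrite addBx (_ : x + h' *: v - _ = (h' - h) *: v); last first.
  by rewrite opprD addrACA subrr add0r -scalerBl.
rewrite -scaleNr !dotvZl => h1 h2.
have h3 := ler_wpM2l (ltW h0) h1.
have hh : 0 <= h' - h by rewrite subr_ge0.
have h4 := ler_wpM2l hh h2.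
lra.
Qed.

Let subgradient_slope x y h : subgradient f x y ->
  h * dotv e y <= f (x + h *: e) - f x.
Proof. by move=> /(_ (x + h *: e)); rewrite addKx dotvZl; lra. Qed.

(** Both the difference quotient and the coordinate of the subgradient lie
    between the slopes over the steps [- n.+1%:R^-1] and [n.+1%:R^-1]. *)
Let slope_near x y n h : subgradient f x y -> 0 < `|h| <= n.+1%:R^-1 ->
  `|h^-1 * (f (x + h *: e) - f x) - dotv e y| <= slope_jump n x.
Proof.
move=> fy /andP[h0 hn]; set D := dotv e y; set s : R := n.+1%:R^-1.
have s0 : 0 < s by rewrite invr_gt0.
have ns : n.+1%:R = s^-1 :> R by rewrite invrK.
have up : s^-1 * (f (x + s *: e) - f x) - D <= slope_jump n x.
  rewrite /slope_jump -/s ns.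
  have := subgradient_slope (- s) fy; rewrite scaleNr -/D => h1.
  have : s^-1 * (- s * D) <= s^-1 * (f (x - s *: e) - f x).
    by rewrite ler_wpM2l// invr_ge0 ltW.
  by rewrite mulNr mulrN mulKf ?gt_eqF//; lra.
have dn : D + s^-1 * (f (x - s *: e) - f x) <= slope_jump n x.
  rewrite /slope_jump -/s ns.
  have := subgradient_slope s fy; rewrite -/D => h1.
  have : s^-1 * (s * D) <= s^-1 * (f (x + s *: e) - f x).
    by rewrite ler_wpM2l// invr_ge0 ltW.
  by rewrite mulKf ?gt_eqF//; lra.
have [hp|hm] := ltP 0 h.
  rewrite gtr0_norm// in hn.
  have [+ _] := slope_le x hp hn; rewrite -/s.
  have := subgradient_slope h fy; rewrite -/D => h1 h2.
  have h3 : D <= h^-1 * (f (x + h *: e) - f x) by rewrite ler_pdivlMl.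
  have h4 : h^-1 * (f (x + h *: e) - f x) <= s^-1 * (f (x + s *: e) - f x).
    by rewrite ler_pdivrMl// mulrCA ler_pdivlMl.
  by rewrite ger0_norm; lra.
have {}hm : 0 < - h by rewrite oppr_gt0 lt_neqAle hm andbT -normr_gt0.
rewrite ltr0_norm -?oppr_gt0// in hn.
have [_] := slope_le x hm hn; rewrite -/s scaleNr opprK.
have := subgradient_slope h fy; rewrite -/D => h1 h2.
have h3 : h^-1 * (f (x + h *: e) - f x) <= D.
  by rewrite ler_ndivrMl// -oppr_gt0.
have h4 : - (h^-1 * (f (x + h *: e) - f x)) <= s^-1 * (f (x - s *: e) - f x).
  by rewrite -mulNr -invrN ler_pdivrMl// mulrCA ler_pdivlMl.
by rewrite ler0_norm; lra.
Qed.

Lemma derive_subgradient x y :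
  (forall k, exists n, slope_jump n x < k.+1%:R^-1) -> subgradient f x y ->
  derivable f x e /\ 'D_e f x = dotv e y.
Proof.
move=> jump0 fy.
suff H : h^-1 *: ((f \o shift x) (h *: e) - f x) @[h --> 0^'] --> dotv e y.
  by split; [apply/cvg_ex; exists (dotv e y)|exact: cvg_lim].
apply/cvgrPdist_le => eps eps0.
have [k _ /(_ k (leqnn k))/= kE] := near_infty_natSinv_lt (PosNum eps0).
have [n jn] := jump0 k.
have n0 : 0 < n.+1%:R^-1 :> R by rewrite invr_gt0.
near=> h; rewrite distrC.
apply: (le_trans _ (ltW (lt_trans jn kE))).
rewrite /= [_ *: _]/(_ * _) (addrC _ x); apply: slope_near => //.
rewrite normr_gt0; apply/andP; split.
  by near: h; exact: nbhs_dnbhs_neq.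
by near: h; exact: dnbhs0_le.
Unshelve. all: by end_near. Qed.

Lemma derivable_slope_jump x : derivable f x e ->
  forall k, exists n, slope_jump n x < k.+1%:R^-1.
Proof.
move=> /cvg_ex[l fl] k.
have k0 : 0 < k.+1%:R^-1 / 2 :> R by rewrite divr_gt0 ?invr_gt0.
move/cvgrPdist_lt : fl => /(_ _ k0)[del /= del0 near_l].
have [n _ /(_ n (leqnn n))/= nE] := near_infty_natSinv_lt (PosNum del0).
exists n; set s : R := n.+1%:R^-1.
have s0 : 0 < s by rewrite invr_gt0.
have slope h : `|h| = s -> `|l - h^-1 * (f (x + h *: e) - f x)| < k.+1%:R^-1 / 2.
  move=> hs; have := near_l h; rewrite /= [_ *: _]/(_ * _) (addrC _ x).
  apply; first by rewrite sub0r normrN hs.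
  by rewrite -normr_gt0 hs.
have := slope s (gtr0_norm s0).
have := slope (- s); rewrite normrN gtr0_norm// => /(_ erefl).
rewrite scaleNr invrN /slope_jump -/s.
have -> : n.+1%:R = s^-1 :> R by rewrite invrK.
move: (k.+1%:R^-1) => eps.
rewrite !ltr_norml => /andP[? ?] /andP[? ?]; lra.
Qed.

Lemma measurable_derivable : measurable [set x | derivable f x e].
Proof.
rewrite (_ : [set x | _] =
    \bigcap_k \bigcup_n [set x | slope_jump n x < k.+1%:R^-1]).
  apply: bigcapT_measurable => k; apply: bigcup_measurable => n _.
  rewrite -[X in measurable X]setTI.
  exact: (measurable_slope_jump n measurableT (measurable_itv `]-oo, _[)).
apply/seteqP; split => [x dx k _|x hx].
  by have [n] := derivable_slope_jump dx k; exists n.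
have [y fy] := f_sub x; have [|//] := @derive_subgradient x y _ fy.
by move=> k; have [n _ hn] := hx k I; exists n.
Qed.

(** The derivative is measurable as a total function, the default value where the
    limit does not exist included; this is what makes the image of [rho] under
    a gradient a measure. *)
Lemma measurable_derive : measurable_fun setT (fun x => 'D_e f x).
Proof.
pose D := [set x | derivable f x e].
have mD : measurable D by exact: measurable_derivable.
pose q n x := n.+1%:R * (f (x + n.+1%:R^-1 *: e) - f x).
have mq n : measurable_fun setT (q n).
  have mf : measurable_fun setT f.
    by apply: continuous_measurable_mx; exact: elipschitz_continuous (ltW r0) fr.
  apply: measurable_funM => //; apply: measurable_funB => //.
  apply: (measurableT_comp mf).
  have := @affine_homothety_measurable R d 1 (n.+1%:R^-1 *: e).
  by congr (measurable_fun _ _); apply/funext => x; rewrite scale1r.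
pose g n x : R := \1_D x * q n x + \1_(~` D) x * (point : R).
apply: (@measurable_fun_cvg _ _ _ _ g) => [n|x _].
  have m1 : measurable_fun setT (\1_D : _ -> R) by exact: measurable_indic.
  have m2 : measurable_fun setT (\1_(~` D) : _ -> R).
    by apply: measurable_indic; exact: measurableC.
  by apply: measurable_funD; apply: measurable_funM.
have [Dx|nDx] := pselect (D x); rewrite /g.
  rewrite (_ : (fun n => _) = (q ^~ x)); last first.
    have nCDx : ~ (~` D) x by move/(_ Dx).
    by apply/funext => n; rewrite !indicE mem_set// memNset// mul1r mul0r addr0.
  pose s (h : R) : R := h^-1 *: ((f \o shift x) (h *: e) - f x).
  have cv : s h @[h --> 0^'] --> 'D_e f x by exact: Dx.
  have -> : q ^~ x = s \o harmonic.
    by apply/funext => n; rewrite /q /s /= invrK (addrC _ x).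
  apply: (cvgr_dnbhsP _ _ _).1 cv harmonic _; split; last exact: cvg_harmonic.
  by move=> n; rewrite invr_eq0 pnatr_eq0.
rewrite (_ : (fun n => _) = cst (point : R)); last first.
  apply/funext => n; rewrite !indicE memNset// mem_set//.
  by rewrite mul1r mul0r add0r.
by rewrite /derive dvgP//; exact: cvg_cst.
Qed.

End directional_derivative.

(** * Almost everywhere differentiability *)

Section ae_derivable.
Context (R : realType) (d : nat) (r : R) (r0 : 0 < r) (f : 'rV[R]_d -> R).
Hypotheses (fr : elipschitz r f) (f_sub : forall x, exists y, subgradient f x y).
Variables (e : 'rV[R]_d) (e1 : enorm e <= 1).
Implicit Types (x y : 'rV[R]_d) (h : R) (n k : nat).

(** The sum telescopes to the difference of two slopes of [f]. *)
Let sum_slope_jump n x :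
  \sum_(0 <= j < n.+1) slope_jump f e n (x + (j%:R / n.+1%:R) *: e) <= 2 * r.
Proof.
set s : R := n.+1%:R^-1.
have s0 : 0 < s by rewrite invr_gt0.
have ns : n.+1%:R = s^-1 :> R by rewrite invrK.
pose F (j : nat) := s^-1 * (f (x + (j%:R * s) *: e) - f (x + (j%:R * s - s) *: e)).
have jumpE j : slope_jump f e n (x + (j%:R / n.+1%:R) *: e) = F j.+1 - F j.
  have shiftD a b : x + a *: e + b *: e = x + (a + b) *: e.
    by rewrite -addrA -scalerDl.
  have shiftB a b : x + a *: e - b *: e = x + (a - b) *: e.
    by rewrite -addrA -scalerBl.
  have jS : j.+1%:R * s = j%:R * s + s by rewrite -natr1 mulrDl mul1r.
  rewrite /slope_jump -/s ns /F shiftD shiftB jS addrK; ring.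
under eq_bigr do rewrite jumpE.
rewrite telescope_sumr//.
have lip a b : `|f (x + a *: e) - f (x + (a - s) *: e)| <= r * s.
  apply: (le_trans (fr _ _)); rewrite ler_wpM2l ?(ltW r0)//.
  rewrite opprD addrACA subrr add0r -scalerBl opprB addrCA subrr addr0.
  by rewrite enormZ gtr0_norm// ler_piMr// ltW.
have F_le j : `|F j| <= r.
  rewrite normrM gtr0_norm ?invr_gt0// ler_pdivrMl//.
  by rewrite (mulrC s r); exact: lip.
have := F_le n.+1; have := F_le 0%N; rewrite !ler_norml.
move=> /andP[? ?] /andP[? ?]; lra.
Qed.

(** On each line the jumps of the slope add up to at most [2 * r]. Hence [n]
    translates of the set where the jump is at least [1 / (k + 1)] overlap at
    most [2 * r * (k + 1)] times, whatever [n] is. *)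
Let jump_set_negligible k m :
  (lebesgue_rV R d).-negligible ([set x | forall n, k.+1%:R^-1 <= slope_jump f e n x] `&`
    cball0 d m%:R).
Proof.
set A := _ `&` _.
have mA : measurable A.
  apply: measurableI; last exact: measurable_cball0.
  rewrite (_ : [set x | _] =
      \bigcap_n (slope_jump f e n @^-1` `[k.+1%:R^-1, +oo[)).
    apply: bigcapT_measurable => n; rewrite -[X in measurable X]setTI.
    exact: (measurable_slope_jump r0 fr e n measurableT (measurable_itv _)).
  apply/seteqP; split => [x h n _|x h n]; first by rewrite /= in_itv/= andbT h.
  by have := h n I; rewrite /= in_itv/= andbT.
pose B := @cball0 R d (m%:R + 1).
have mB : measurable B by exact: measurable_cball0.
have Boo := lebesgue_cball0_lty d (m%:R + 1 : R).
pose T n (j : nat) x := x + (j%:R / n.+1%:R) *: e.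
have mTA n j : measurable (T n j @^-1` A).
  rewrite -[X in measurable X]setTI.
  have := @affine_homothety_measurable R d 1 ((j%:R / n.+1%:R) *: e) measurableT _ mA.
  by congr measurable; apply/seteqP; split => x /=; rewrite scale1r.
have TAB n j : (j < n.+1)%N -> T n j @^-1` A `<=` B.
  move=> jn x [_]; rewrite /T /cball0/= => xm.
  rewrite /B/cball0/= -(addrK ((j%:R / n.+1%:R) *: e) x).
  apply: (le_trans (enormD _ _)); rewrite enormN; apply: lerD => //.
  rewrite enormZ ger0_norm ?divr_ge0//.
  rewrite mulr_ile1 ?divr_ge0 ?enorm_ge0//.
  by rewrite ler_pdivrMr// mul1r ler_nat ltnW.
have TAE n j : lebesgue_rV R d (T n j @^-1` A) = lebesgue_rV R d A.
  by rewrite [RHS](lebesgue_translation ((j%:R / n.+1%:R) *: e) mA).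
pose c := 2 * r * k.+1%:R.
have c0 : 0 <= c by rewrite mulr_ge0// mulr_ge0// ltW.
have overlap n x : \sum_(0 <= j < n.+1) \1_(T n j @^-1` A) x <= c.
  rewrite /c -ler_pdivrMr//; apply: le_trans (sum_slope_jump n x).
  rewrite mulr_suml; apply: ler_sum => j _; rewrite indicE.
  have [/set_mem[h _]|_] := boolP (_ \in _); first by rewrite mul1r; exact: h.
  by rewrite mul0r slope_jump_ge0.
have bound n : (n.+1%:R%:E * lebesgue_rV R d A <= c%:E * lebesgue_rV R d B)%E.
  have -> : (n.+1%:R%:E * lebesgue_rV R d A =
      \sum_(0 <= j < n.+1) \int[lebesgue_rV R d]_(x in B)
        (\1_(T n j @^-1` A) x)%:E)%E.
    rewrite (eq_big_nat _ _ (F2 := fun=> lebesgue_rV R d A)).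
      by rewrite big_const_nat subn0 iter_addr_0 mule_natl.
    move=> j /andP[_ jn]; rewrite integral_indic// -(TAE n j).
    by rewrite setIidl//; exact: TAB.
  have m1 j : measurable_fun B (fun x => (\1_(T n j @^-1` A) x : R)%:E).
    by apply/measurable_EFinP; exact: measurable_indic.
  have i0 j x : (0 <= (\1_(T n j @^-1` A) x : R)%:E)%E by rewrite lee_fin.
  rewrite -ge0_integral_sum// -integral_cst//; apply: ge0_le_integral => //.
  - by move=> x _; exact: sume_ge0.
  - exact: emeasurable_sum.
  - by move=> x _; rewrite sumEFin lee_fin; exact: overlap.
have cBoo : (c%:E * lebesgue_rV R d B < +oo)%E by rewrite lte_mul_pinfty.
have Aoo : (lebesgue_rV R d A < +oo)%E.
  by have := bound 0%N; rewrite mul1e => /le_lt_trans; exact.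
have cBfin : (c%:E * lebesgue_rV R d B)%E \is a fin_num.
  by rewrite ge0_fin_numE// mule_ge0// lee_fin.
have Afin : lebesgue_rV R d A \is a fin_num by rewrite ge0_fin_numE.
suff A0 : lebesgue_rV R d A = 0%E by apply/negligibleP.
rewrite -(fineK Afin); congr EFin; apply/eqP.
set a := fine _; set K := fine (c%:E * lebesgue_rV R d B)%E.
have a0 : 0 <= a by exact: fine_ge0.
rewrite eq_le a0 andbT leNgt; apply/negP => {}a0.
have aK n : n.+1%:R * a <= K.
  by rewrite -lee_fin EFinM /a /K !fineK.
have K0 : 0 <= K / a by rewrite divr_ge0 ?(ltW a0)//; apply: le_trans (aK 0%N); rewrite mul1r ltW.
have := archi_boundP K0; rewrite ltNge => /negP; apply.
rewrite ler_pdivlMr//; apply: le_trans (aK _).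
by rewrite ler_wpM2r ?(ltW a0)// ler_nat.
Qed.

Lemma lebesgue_not_derivable : lebesgue_rV R d [set x | ~ derivable f x e] = 0%E.
Proof.
have mD := measurable_derivable r0 fr f_sub e.
apply/negligibleP; first exact: measurableC mD.
have : (lebesgue_rV R d).-negligible (\bigcup_k \bigcup_m
    ([set x | forall n, k.+1%:R^-1 <= slope_jump f e n x] `&` cball0 d m%:R)).
  by apply: negligible_bigcup => k; exact: negligible_bigcup.
apply: negligibleS => x ndx.
have [y fy] := f_sub x.
have [k hk] : exists k, forall n, k.+1%:R^-1 <= slope_jump f e n x.
  apply: contrapT => nk; apply: ndx.
  have [|//] := @derive_subgradient _ _ f f_sub e x y _ fy.
  move=> k; apply: contrapT => nn; apply: nk; exists k => n.
  by rewrite leNgt; apply/negP => jn; apply: nn; exists n.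
exists k => //; exists (Num.bound (enorm x)) => //; split => //.
by rewrite /cball0/= ltW// archi_boundP// enorm_ge0.
Qed.

End ae_derivable.

(** * Gradients of conjugates *)

Lemma integral_bigcup_le d (T : measurableType d) (R : realType)
    (mu : {measure set T -> \bar R}) N (C : 'I_N -> set T) (f : T -> \bar R) :
  (forall i, measurable (C i)) -> measurable_fun setT f ->
  (forall x, 0 <= f x)%E ->
  (\int[mu]_(x in \bigcup_(i in [set: 'I_N]) C i) f x <=
    \sum_(i < N) \int[mu]_(x in C i) f x)%E.
Proof.
move=> mC mf f0.
under [leRHS]eq_bigr do rewrite integral_mkcond.
rewrite -ge0_integral_sum//; last 2 first.
- by move=> i; apply/(measurable_restrictT _ (mC i)); exact: measurable_funTS.
- by move=> i x _; exact: erestrict_ge0.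
have mU : measurable (\bigcup_(i in [set: 'I_N]) C i).
  by apply: fin_bigcup_measurable.
rewrite integral_mkcond; apply: ge0_le_integral => //.
- by move=> x _; exact: erestrict_ge0.
- by apply/(measurable_restrictT _ mU); exact: measurable_funTS.
- apply: emeasurable_sum => i.
  by apply/(measurable_restrictT _ (mC i)); exact: measurable_funTS.
- move=> x _; rewrite patchE; case: ifPn => [/set_mem[i _ Cx]|_].
    rewrite (bigD1 i)//= patchE mem_set// leeDl//.
    by apply: sume_ge0 => j _; exact: erestrict_ge0.
  by apply: sume_ge0 => j _; exact: erestrict_ge0.
Qed.

Section gradient_conjugate.
Context (R : realType) (d : nat) (r : R) (r0 : 0 < r) (psi : 'rV[R]_d -> R).
Hypothesis psi_continuous : {within cball0 d r, continuous psi}.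
Local Notation phi := (conjugate (cball0 d r) psi).

Let phi_sub x : exists y, subgradient phi x y.
Proof.
have [y yr phix] := conjugate_attained r0 psi_continuous x.
by exists y; exact: (maximizer_subgradient r0 psi_continuous yr phix).
Qed.

Let phi_lip := conjugate_lipschitz r0 psi_continuous.

Lemma measurable_gradient_conjugate : measurable_fun setT (gradient phi).
Proof.
apply: measurable_fun_mx => i j.
rewrite (_ : (fun _ => _) = (fun x => 'D_(delta_mx ord0 j) phi x)).
  exact: (measurable_derive r0 phi_lip phi_sub).
by apply/funext => x; rewrite mxE.
Qed.

Let enorm_delta i : enorm (delta_mx ord0 i : 'rV[R]_d) <= 1.
Proof. by rewrite /enorm dotv_delta mxE !eqxx sqrtr1. Qed.

(** Where the partial derivatives exist, they are the coordinates of the only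
    subgradient, which is the point where the supremum is attained. *)
Lemma gradient_conjugate_maximizer : exists A, [/\ measurable A,
  lebesgue_rV R d A = 0%E &
  forall x, ~ A x -> cball0 d r (gradient phi x) /\
    phi x = dotv x (gradient phi x) - psi (gradient phi x)].
Proof.
pose E i := [set x | ~ derivable phi x (delta_mx ord0 i)].
have mE i : measurable (E i).
  exact: measurableC (measurable_derivable r0 phi_lip phi_sub (delta_mx ord0 i)).
exists (\bigcup_(i in [set: 'I_d]) E i); split.
- exact: fin_bigcup_measurable.
- have mU : measurable (\bigcup_(i in [set: 'I_d]) E i).
    exact: fin_bigcup_measurable.
  apply/eqP; rewrite eq_le measure_ge0 andbT.
  have := @integral_bigcup_le _ _ R (lebesgue_rV R d) d E (cst 1%E) mE.
  rewrite integral_cst// mul1e => /(_ _ _)/le_trans; apply => //.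
  rewrite big1// => i _; rewrite integral_cst// mul1e.
  exact: (lebesgue_not_derivable r0 phi_lip phi_sub (enorm_delta i)).
- move=> x nE.
  have [y yr phix] := conjugate_attained r0 psi_continuous x.
  have suby := maximizer_subgradient r0 psi_continuous yr phix.
  suff -> : gradient phi x = y by [].
  apply/rowP => i; rewrite mxE -(dotv_delta i y).
  have dx : derivable phi x (delta_mx ord0 i).
    by apply: contrapT => ndx; apply: nE; exists i.
  have jump := derivable_slope_jump dx.
  by have [_ ->] := derive_subgradient phi_sub jump suby.
Qed.

End gradient_conjugate.

(** * Variance and gain *)

(** The mean minimizes the mean square deviation. *)
Lemma variance_le d (T : measurableType d) (R : realType) (P : probability T R)
    (X : T -> R) (a : R) : measurable_fun setT X ->
  ('V_P[X] <= \int[P]_x ((X x - a) ^+ 2)%:E)%E.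
Proof.
move=> mX; have [->|oo] := eqVneq (\int[P]_x ((X x - a) ^+ 2)%:E)%E +oo%E.
  by rewrite leey.
have mXa : measurable_fun setT (X \- cst a) by exact: measurable_funB.
have LXa : (X \- cst a)%R \in Lfun P 2%:E.
  rewrite inE/=; apply/andP; split; rewrite inE//=.
  rewrite /finite_norm unlock /Lnorm poweR_lty//.
  rewrite (eq_integral (fun x => ((X x - a) ^+ 2)%:E)) ?ltey//.
  by move=> x _; rewrite /= powR_mulrn// real_normK// num_real.
have LX : X \in Lfun P 2%:E.
  rewrite (_ : X = (X \- cst a) \+ cst a); last first.
    by apply/funext => x /=; rewrite subrK.
  by rewrite rpredD ?lee1n//= ?Lfun_cst.
rewrite -(varianceB_cst_r a LX) varianceE// unlock.
rewrite -[leRHS]adde0; apply: leeD => //.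
by rewrite oppe_le0 sqre_ge0.
Qed.

Section variance_gain.
Context (R : realType) (d : nat) (r : R) (r0 : 0 < r)
  (rho : probability 'rV[R]_d R) (rho_ac : rho `<< lebesgue_rV R d)
  (rho_bounds : exists m M : R, [/\ 0 < m, 0 < M &
    {ae lebesgue_rV R d, forall x,
      spt rho x -> (m%:E <= density rho x <= M%:E)%E}])
  (rho_connected : connected (spt rho))
  (N : nat) (C : 'I_N -> set 'rV[R]_d)
  (C_convex : forall i, convex_set (C i))
  (C_closed : forall i, closed (C i))
  (C_ball : forall i, C i `<=` cball0 d r)
  (C_cover : spt rho = \bigcup_(i in [set: 'I_N]) C i)
  (C_overlap : forall i j : 'I_N, i != j -> C i `&` C j !=set0 ->
    (0 < rho (C i `&` C j))%E).
Local Open Scope ereal_scope.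

(** The pairs (difference of two Lipschitz functions, integral of their gain)
    over which the constants have to be uniform. *)
Let gain_of (u : 'rV[R]_d -> R) (J : \bar R) := exists f g,
  [/\ elipschitz r f, elipschitz r g, u = (g - f)%R &
      J = \int[rho]_x (shift_gain r f g x)%:E].

Let gain_of_measurable u J : gain_of u J -> measurable_fun setT u.
Proof.
move=> [f [g [fr gr -> _]]].
have cf := elipschitz_continuous (ltW r0) fr.
have cg := elipschitz_continuous (ltW r0) gr.
by apply: measurable_funB; exact: continuous_measurable_mx.
Qed.

Let gain_of_ge0 u J : gain_of u J -> 0 <= J.
Proof.
move=> [f [g [fr gr _ ->]]]; apply: integral_ge0 => x _.
by rewrite lee_fin shift_gain_ge0.
Qed.

(** A Poincare inequality in which the gain plays the role of the energy: it holds
    on each convex piece, and propagates through the overlaps. *)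
Lemma variance_le_gain : exists2 K : R, (0 <= K)%R & forall f g,
  elipschitz r f -> elipschitz r g ->
  'V_rho[(g \- f)%R] <= K%:E * \int[rho]_x (shift_gain r f g x)%:E.
Proof.
have [m [M [m0 M0 bounds]]] := rho_bounds.
have C_spt i : C i `<=` spt rho by move=> x Cx; rewrite C_cover; exists i.
have mC i : measurable (C i) by exact: closed_measurable_mx.
have base i : 0 < rho (C i) -> common_deviation rho C gain_of [set i]%SET.
  move=> Ci0; exists (64 * r ^+ 2 * distortion d m M)%R.
    apply: mulr_ge0; last exact: distortion_ge0.
    by apply: mulr_ge0 => //; exact: sqr_ge0.
  move=> u J [f [g [fr gr -> ->]]].
  have [a ha] := poincare_convex r0 m0 M0 rho_ac bounds (@C_closed i)
    (@C_convex i) (@C_spt i) (@C_ball i) fr gr Ci0.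
  by exists a => j; rewrite inE => /eqP ->.
have pieces (h : 'rV[R]_d -> \bar R) : measurable_fun setT h ->
    (forall x, 0 <= h x) ->
    \int[rho]_x h x <= \sum_(i < N) \int[rho]_(x in C i) h x.
  move=> mh h0.
  have mCspt : measurable (~` spt rho).
    by apply: measurableC; apply: closed_measurable_mx; exact: closed_spt.
  rewrite (ge0_negligible_integral mCspt measurableT mh)//; last first.
    exact: setC_spt_null.
  by rewrite setTD setCK C_cover; exact: integral_bigcup_le.
have [i0 Ci0] : exists i, 0 < rho (C i).
  apply: contrapT => nC.
  have := pieces (cst 1) (measurable_cst _) (fun=> lee01).
  rewrite integral_cst// [X in _ * X]probability_setT mule1 big1; first by rewrite lee_fin ler10.
  move=> i _; rewrite integral_cst// mul1e.
  apply/eqP; rewrite eq_le measure_ge0 andbT leNgt; apply/negP => Ci.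
  by apply: nC; exists i.
have conn := rho_connected; rewrite C_cover in conn.
have [c c0 hc] := common_deviation_setT C_closed gain_of_measurable gain_of_ge0
  base Ci0 conn C_overlap.
exists (N%:R * c)%R; first exact: mulr_ge0.
move=> f g fr gr; set J := \int[rho]_x _.
have gfJ : gain_of (g - f)%R J by exists f, g.
have [a ha] := hc _ _ gfJ; have mu_ := gain_of_measurable gfJ.
apply: (le_trans (variance_le rho a mu_)).
have msq : measurable_fun setT (fun x => ((((g - f) x - a) ^+ 2)%R)%:E).
  by apply/measurable_EFinP; apply: measurable_funX; exact: measurable_funB.
have sq0 x : 0 <= ((((g - f) x - a) ^+ 2)%R)%:E by rewrite lee_fin sqr_ge0.
apply: (le_trans (pieces _ msq sq0)).
apply: (@le_trans _ _ (\sum_(i < N) c%:E * J)).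
  by apply: lee_sum => i _; apply: ha; rewrite inE.
by rewrite big_const_ord iter_addr_0 EFinM -muleA mule_natl.
Qed.

End variance_gain.

(** * The gap of the Kantorovich functional *)

Section within_continuous.
Context (R : realType) (d : nat) (f : 'rV[R]_d -> R) (A : set 'rV[R]_d).
Hypotheses (A_compact : compact A) (f_continuous : {within A, continuous f}).

Lemma within_continuous_measurable : closed A -> measurable_fun A f.
Proof.
move=> cA; have mA := closed_measurable_mx cA.
apply: (measurability _ (RGenOpens.measurableE R)).
move=> _ [_ [a [b ->]] <-].
have oI : open (`]a, b[%classic : set R) by exact: interval_open.
have /continuousP/(_ _ oI)/open_subspaceP[V oV VA] := f_continuous.
rewrite setIC -VA; apply: measurableI => //.
exact: open_measurable_mx.
Qed.

Lemma within_continuous_bounded : exists M, forall x, A x -> `|f x| <= M.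
Proof.
have [->|/set0P A0] := eqVneq A set0; first by exists 0.
have [b _ fb] := compact_EVT_max A0 A_compact f_continuous.
have [a _ fa] := compact_EVT_min A0 A_compact f_continuous.
exists (`|f a| + `|f b|) => x Ax; have := fa x (mem_set Ax).
have := fb x (mem_set Ax); have := ler_norm (f b); have := ler_norm (- f a).
rewrite normrN; have := normr_ge0 (f a); have := normr_ge0 (f b).
by move=> *; rewrite ler_norml; apply/andP; split; lra.
Qed.

End within_continuous.

Section kantorovich_gap.
Context (R : realType) (d : nat) (r : R) (r0 : 0 < r)
  (rho : probability 'rV[R]_d R) (rho_ball : rho (cball0 d r) = 1%E)
  (rho_ac : rho `<< lebesgue_rV R d).
Variables (psi psit : 'rV[R]_d -> R).
Hypotheses (psi_continuous : {within cball0 d r, continuous psi})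
  (psit_continuous : {within cball0 d r, continuous psit}).
Local Notation B := (cball0 d r).
Local Notation phi := (conjugate B psi).
Local Notation phit := (conjugate B psit).
Local Open Scope ereal_scope.

Let mB : measurable (B : set 'rV[R]_d). Proof. exact: measurable_cball0. Qed.

Let rho_lty A : measurable A -> rho A < +oo.
Proof. by move=> mA; apply: le_lt_trans (probability_le1 _ mA) (ltry 1). Qed.

Let integrable_bounded A (f : 'rV[R]_d -> R) M : measurable A ->
  measurable_fun A f -> (forall x, A x -> `|f x| <= M)%R ->
  rho.-integrable A (EFin \o f).
Proof.
move=> mA mf fM; apply: measurable_bounded_integrable => //.
  exact: rho_lty.
exists M; split; first exact: num_real.
by move=> M' MM' x Ax; exact: le_trans (fM _ Ax) (ltW MM').
Qed.

Let integrable_lipschitz (f : 'rV[R]_d -> R) : elipschitz r f ->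
  rho.-integrable B (EFin \o f).
Proof.
move=> fr; have cf := elipschitz_continuous (ltW r0) fr.
have [M fM] := within_continuous_bounded (@compact_cball0 R d r)
  (continuous_subspaceT cf).
apply: integrable_bounded fM => //.
exact: measurable_funTS (continuous_measurable_mx cf).
Qed.

(** At almost every [x] the gradient of the first conjugate is the point [y] where
    the supremum is attained. There the Fenchel equality turns the difference of
    the two integrands into the Fenchel-Young gap of the pair [(x, y)] for the
    second function, which dominates the gain. *)
Lemma kantorovich_gap :
  \int[pushforward rho (gradient phi)]_(y in B) (psi y - psit y)%:E +
    \int[rho]_x (shift_gain r phi phit x)%:E <=
  kantorovich B rho psit - kantorovich B rho psi.
Proof.
have phi_lip := conjugate_lipschitz r0 psi_continuous.
have phit_lip := conjugate_lipschitz r0 psit_continuous.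
set T := gradient phi.
have mT : measurable_fun setT T := measurable_gradient_conjugate r0 psi_continuous.
have [A [mA A0 AT]] := gradient_conjugate_maximizer r0 psi_continuous.
have rhoA : rho A = 0.
  by move/null_content_dominatesP : rho_ac; exact.
pose E := B `\` A.
have mE : measurable E by exact: measurableD.
have rhoE : rho (~` E) = 0.
  have mCB := measurableC mB.
  have CB0 : rho (~` (B : set 'rV[R]_d)) <= 0.
    by rewrite probability_setC// rho_ball subee.
  have A_le0 : rho A <= 0 by rewrite rhoA.
  have -> : ~` E = ~` B `|` A by rewrite /E setDE setCI setCK.
  apply/eqP; rewrite eq_le measure_ge0 andbT.
  exact: le_trans (measureU2 _ mCB mA) (adde_le0 CB0 A_le0).
have restrictE (f : 'rV[R]_d -> R) : rho.-integrable B (EFin \o f) ->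
    \int[rho]_(x in B) (f x)%:E = \int[rho]_(x in E) (f x)%:E.
  by move=> intf; exact: negligible_integral.
pose h := (psi \- psit)%R \_ B.
have mh : measurable_fun setT h.
  apply/(measurable_restrictT _ mB); apply: measurable_funB.
    exact: within_continuous_measurable psi_continuous (@closed_cball0 R d r).
  exact: within_continuous_measurable psit_continuous (@closed_cball0 R d r).
have [M hM] : exists M, forall y, (`|h y| <= M)%R.
  have [M1 psiM] := within_continuous_bounded (@compact_cball0 R d r) psi_continuous.
  have [M2 psitM] := within_continuous_bounded (@compact_cball0 R d r) psit_continuous.
  exists (M1 + M2)%R => y; rewrite /h patchE; case: ifPn => [/set_mem By|_].
    by apply: (le_trans (ler_normB _ _)); apply: lerD; [exact: psiM|exact: psitM].
  have z := @cball0_0 R d r (ltW r0).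
  by rewrite normr0 addr_ge0// (le_trans (normr_ge0 _) (psiM _ z), le_trans (normr_ge0 _) (psitM _ z)).
have mhT : measurable_fun setT (h \o T) by exact: measurableT_comp mh mT.
have int_hT D : measurable D -> rho.-integrable D (EFin \o (h \o T)).
  move=> mD; apply: (@integrable_bounded D (h \o T) M) => //.
    exact: measurable_funTS.
  by move=> x _; exact: hM.
have mTB : measurable (T @^-1` B).
  by rewrite -[X in measurable X]setTI; exact: mT.
rewrite [X in X + _](_ : _ = \int[rho]_(x in E) (h (T x))%:E); last first.
  transitivity (\int[pushforward rho T]_(y in B) (h y)%:E).
    apply: eq_integral; first exact: mT.
    by move=> y yB; rewrite /h patchE yB.
  have mEh : measurable_fun setT (EFin \o h) by exact/measurable_EFinP.
  rewrite (integral_pushforward mT mEh)//; last exact: int_hT.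
  rewrite (negligible_integral _ _ _ rhoE)//; last 2 first.
  - exact: measurableC.
  - exact: int_hT.
  congr integral; rewrite setDE setCK.
  by apply/seteqP; split => [x []//|x [Bx nA]]; split => //; have [] := AT x nA.
have mG : measurable_fun setT (EFin \o shift_gain r phi phit).
  by apply/measurable_EFinP; apply: continuous_measurable_mx; exact: continuous_shift_gain.
have G0 x : 0 <= (shift_gain r phi phit x)%:E.
  by rewrite lee_fin shift_gain_ge0.
have intG : rho.-integrable E (EFin \o shift_gain r phi phit).
  apply: (@integrable_bounded E (shift_gain r phi phit) (2 * r ^+ 2)%R) => //.
    by apply: measurable_funTS; exact/measurable_EFinP.
  move=> x _; rewrite ger0_norm; last by rewrite -lee_fin.
  exact: shift_gain_le.
have -> : \int[rho]_x (shift_gain r phi phit x)%:E =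
    \int[rho]_(x in E) (shift_gain r phi phit x)%:E.
  rewrite (ge0_negligible_integral (measurableC mE) measurableT mG _ rhoE).
    by rewrite setTD setCK.
  by move=> x _; exact: G0.
have EB : E `<=` B by move=> x [].
have iphi := integrable_lipschitz phi_lip.
have iphit := integrable_lipschitz phit_lip.
rewrite /kantorovich (restrictE _ iphi) (restrictE _ iphit).
have iphiE := integrableS mB mE EB iphi.
have iphitE := integrableS mB mE EB iphit.
rewrite -integralB// -integralD//; last exact: int_hT.
apply: le_integral => //.
- by apply: integrableD => //; exact: int_hT.
- exact: integrableB.
move=> x /set_mem[Bx nAx]; rewrite -EFinD lee_fin.
have [Tx phix] := AT _ nAx.
rewrite -lerBrDl; apply: (shift_gain_lub r0 phi_lip phit_lip) => w wr.
rewrite /h patchE mem_set//.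
exact: (fenchel_gap_ge w r0 psi_continuous psit_continuous Tx phix).
Qed.

End kantorovich_gap.

(* The C i are taken closed. Without this the statement fails for d >= 2: let
   spt(rho) be two triangles meeting at one vertex only, C 0 the first one and
   C 1 the second one minus that vertex, so that C 0 and C 1 are disjoint. *)
Theorem propositionB2 (R : realType) (d : nat) (r : R) (hr : 0 < r)
    (rho : probability 'rV[R]_d R)
    (rho_ball : rho (cball0 d r) = 1%E)
    (rho_ac : rho `<< lebesgue_rV R d)
    (rho_bounds : exists m M : R, [/\ 0 < m, 0 < M &
      {ae lebesgue_rV R d, forall x,
        spt rho x -> (m%:E <= density rho x <= M%:E)%E}])
    (rho_connected : connected (spt rho))
    (N : nat) (hN : (0 < N)%N) (C : 'I_N -> set 'rV[R]_d)
    (C_convex : forall i, convex_set (C i))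
    (C_closed : forall i, closed (C i))
    (C_ball : forall i, C i `<=` cball0 d r)
    (C_cover : spt rho = \bigcup_(i in [set: 'I_N]) C i)
    (C_overlap : forall i j : 'I_N, i != j -> C i `&` C j !=set0 ->
      (0 < rho (C i `&` C j))%E) :
  exists2 c : R, 0 < c &
    forall psi psit : 'rV[R]_d -> R,
      {within cball0 d r, continuous psi} ->
      {within cball0 d r, continuous psit} ->
      (\int[pushforward rho (gradient (conjugate (cball0 d r) psi))]_(y in cball0 d r)
          (psi y - psit y)%:E
        + c%:E * 'V_rho[(conjugate (cball0 d r) psit
                            \- conjugate (cball0 d r) psi)%R]
       <= kantorovich (cball0 d r) rho psit - kantorovich (cball0 d r) rho psi)%E.
Proof.
have [K K0 varK] := variance_le_gain hr rho_ac rho_bounds rho_connected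
  C_convex C_closed C_ball C_cover C_overlap.
have K1 : 0 < K + 1 by rewrite ltr_wpDl.
exists (K + 1)^-1; first by rewrite invr_gt0.
move=> psi psit cpsi cpsit.
apply: le_trans (kantorovich_gap hr rho_ball rho_ac cpsi cpsit).
have phi_lip := conjugate_lipschitz hr cpsi.
have phit_lip := conjugate_lipschitz hr cpsit.
rewrite leeD2l// lee_pdivrMl//; apply: le_trans (varK _ _ phi_lip phit_lip) _.
apply: lee_wpmul2r; last by rewrite lee_fin lerDl.
by apply: integral_ge0 => x _; rewrite lee_fin (shift_gain_ge0 hr phi_lip phit_lip).
Qed.
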